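(* Let $F$ be a field of characteristic $\ell\neq 2$, let $n\geq 1$ be odd, and let $f:V\times V\to F$ be a bilinear form on a finite dimensional $F$-vector space $V$ having Gram matrix $A_n(-1)=\begin{pmatrix}0&I_n\\ J_n(-1)&0\end{pmatrix}$ relative to some basis of $V$. Then $L(f)$ has dimension $2n+1$ and is isomorphic to the current truncated Lie algebra $\mathfrak{gl}(2,F)\otimes F[X]/(X^{(n+1)/2})$ modulo a one dimensional central ideal. In particular, $L(f)$ is reductive if and only if $n=1$. Moreover, let $W=\ker\sigma^{-+}$ and set $$K=\{x\in L(f)\mid xV\subseteq W\text{ and } xW=0\}.$$ Then $K$ is an abelian ideal of $L(f)$, not contained in the center of $L(f)$ provided $n>1$.
   Context: $L(f)=\{x\in\mathfrak{gl}(V)\mid f(xv,w)=-f(v,xw)\ \text{for all } v,w\in V\}$. A Lie algebra is called reductive if every solvable ideal is central. $J_n(\lambda)$ is the $n\times n$ lower triangular Jordan block with eigenvalue $\lambda$. The bracket on $\mathfrak{g}\otimes F[X]/(X^k)$ is $[a\otimes p,b\otimes q]=[a,b]\otimes pq$. Set $f^{+}(u,v)=f(u,v)+f(v,u)$ and $f^{-}(u,v)=f(u,v)-f(v,u)$. In the present situation $f^-$ is non-degenerate, and $\sigma^{-+}\in\mathrm{End}(V)$ denotes the unique endomorphism such that $f^+(u,v)=f^-(u,\sigma^{-+}v)$ for all $u,v\in V$. *)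

(* Defs.v *)
From HB Require Import structures.
From mathcomp Require Import all_boot all_order all_algebra.

Set Implicit Arguments.
Unset Strict Implicit.
Unset Printing Implicit Defensive.

Import GRing.Theory.
Local Open Scope ring_scope.

HB.mixin Record Lmodule_isLieAlgebra (F : fieldType) (g : Type)
    of GRing.Lmodule F g := {
  lie : g -> g -> g;
  lie_bilinear_subproof : bilinear_for *:%R *:%R lie;
  liexx : forall x, lie x x = 0;
  lie_jacobi : forall x y z,
    lie x (lie y z) + lie y (lie z x) + lie z (lie x y) = 0
}.

#[short(type="lieAlgType")]
HB.structure Definition LieAlgebra (F : fieldType) :=
  { g of Lmodule_isLieAlgebra F g & GRing.Lmodule F g }.

#[short(type="finLieAlgType")]
HB.structure Definition FinLieAlgebra (F : fieldType) :=
  { g of LieAlgebra F g & Vector F g }.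

HB.instance Definition _ (F : fieldType) (g : lieAlgType F) :=
  bilinear_isBilinear.Build F g g g *:%R *:%R (@lie F g)
    (@lie_bilinear_subproof F g).

HB.instance Definition _ (F : fieldType) (g : lieAlgType F) (x : g) :=
  GRing.isLinear.Build F g g *:%R (lie x) ((@lie_bilinear_subproof F g).2 x).

Lemma lie_skew (F : fieldType) (g : lieAlgType F) (x y : g) :
  lie x y = - lie y x.
Proof.
have := liexx (x + y).
rewrite linearDl !linearDr /= !liexx add0r addr0 => /eqP.
by rewrite addr_eq0 => /eqP.
Qed.

Definition lie_isomorphic (F : fieldType) (g h : lieAlgType F) : Prop :=
  exists phi : {linear g -> h},
    bijective phi /\ forall x y, phi (lie x y) = lie (phi x) (phi y).

Section FinLieTheory.
Variables (F : fieldType) (g : finLieAlgType F).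
Implicit Types (x y : g) (U W I : {vspace g}).

(** One side suffices by [lie_skew]. *)
Definition lie_ideal I : Prop :=
  forall x y, y \in I -> lie x y \in I.

Definition lie_abelian I : Prop := {in I &, forall x y, lie x y = 0}.

Definition ad x : 'End(g) := linfun (lie x).

Fact ad_is_linear : linear ad.
Proof.
move=> a x y; apply/lfunP => z; rewrite /ad.
by rewrite add_lfunE scale_lfunE !lfunE /= linearPl.
Qed.
HB.instance Definition _ := GRing.isLinear.Build F g 'End(g) _ ad ad_is_linear.

Definition lie_center : {vspace g} := lker (linfun ad).

Lemma lie_centerP x : reflect (forall y, lie x y = 0) (x \in lie_center).
Proof.
rewrite memv_ker lfunE; apply: (iffP eqP) => /= [adx y|cx].
  by rewrite -[lie x y](lfunE (lie x)) -/(ad x) adx zero_lfunE.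
by apply/lfunP => y; rewrite zero_lfunE lfunE; apply: cx.
Qed.

Definition lie_span U W : {vspace g} :=
  <<[seq lie x y | x <- vbasis U, y <- vbasis W]>>%VS.

Lemma mem_lie_span U W x y : x \in U -> y \in W -> lie x y \in lie_span U W.
Proof.
move=> /coord_vbasis -> /coord_vbasis ->; rewrite linear_sumr /=.
apply: rpred_sum => j _; rewrite linear_sumlz /=; apply: rpred_sum => i _.
rewrite linearZl_LR linearZr_LR /=; do 2!apply: rpredZ.
by apply: memv_span; apply/allpairsP; exists ((vbasis U)`_i, (vbasis W)`_j);
  split=> //=; apply: mem_nth; rewrite size_tuple.
Qed.

Lemma lie_span_min U W I :
  (forall x y, x \in U -> y \in W -> lie x y \in I) -> (lie_span U W <= I)%VS.
Proof.
move=> UWI; apply/span_subvP => _ /allpairsP[[x y] [/= xU yW ->]].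
by apply: UWI; apply: vbasis_mem.
Qed.

Definition derived_series I (m : nat) : {vspace g} :=
  iter m (fun U => lie_span U U) I.

Definition lie_solvable I : Prop := exists m, derived_series I m = 0%VS.

Definition lie_reductive : Prop :=
  forall I, lie_ideal I -> lie_solvable I -> (I <= lie_center)%VS.

Record lieIdeal := LieIdeal {
  lieIdeal_space :> {vspace g};
  lieIdealP : lie_ideal lieIdeal_space
}.

End FinLieTheory.

Arguments lie_center {F} g.
Arguments lie_reductive {F} g.
Arguments lieIdeal {F} g.

Section QuotientLie.
Variables (F : fieldType) (g : finLieAlgType F) (Z : lieIdeal g).
Local Open Scope quotient_scope.

Definition quot_lie := Quotient.quot (lieIdeal_space Z).
HB.instance Definition _ := GRing.Zmodule.on quot_lie.

Definition quot_proj (x : g) : quot_lie := \pi_(Quotient.quot (lieIdeal_space Z)) x.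

Lemma quot_projP (x y : g) :
  reflect (quot_proj x = quot_proj y) (x - y \in lieIdeal_space Z).
Proof. by rewrite Quotient.idealrBE; apply: eqP. Qed.

Lemma quot_projD : {morph quot_proj : x y / x + y}.
Proof. by move=> x y; rewrite /quot_proj raddfD. Qed.

Lemma quot_proj_repr (x : quot_lie) : quot_proj (repr x) = x.
Proof. exact: reprK. Qed.

Lemma repr_quot_proj x : repr (quot_proj x) - x \in lieIdeal_space Z.
Proof. by apply/quot_projP; rewrite quot_proj_repr. Qed.

Definition quot_scale (a : F) (x : quot_lie) : quot_lie :=
  quot_proj (a *: repr x).
Definition quot_bracket (x y : quot_lie) : quot_lie :=
  quot_proj (lie (repr x) (repr y)).

Lemma quot_scaleE a x : quot_scale a (quot_proj x) = quot_proj (a *: x).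
Proof. by apply/quot_projP; rewrite -scalerBr rpredZ ?repr_quot_proj. Qed.

Lemma quot_bracketE x y :
  quot_bracket (quot_proj x) (quot_proj y) = quot_proj (lie x y).
Proof.
apply/quot_projP.
set x' := repr _; set y' := repr _.
rewrite -(subrKA (lie x y')) -linearBr -linearBl rpredD //=.
  by rewrite lie_skew rpredN lieIdealP // repr_quot_proj.
by rewrite lieIdealP // repr_quot_proj.
Qed.

Fact quot_scaleA a b x : quot_scale a (quot_scale b x) = quot_scale (a * b) x.
Proof. by rewrite -(quot_proj_repr x) !quot_scaleE scalerA. Qed.
Fact quot_scale1 : left_id 1 quot_scale.
Proof. by move=> x; rewrite -(quot_proj_repr x) !quot_scaleE scale1r. Qed.
Fact quot_scaleDr : right_distributive quot_scale +%R.
Proof.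
move=> a x y; rewrite -(quot_proj_repr x) -(quot_proj_repr y).
by rewrite -quot_projD !quot_scaleE scalerDr quot_projD.
Qed.
Fact quot_scaleDl x : {morph quot_scale^~ x : a b / a + b}.
Proof.
by move=> a b; rewrite -(quot_proj_repr x) !quot_scaleE scalerDl quot_projD.
Qed.
HB.instance Definition _ := GRing.Zmodule_isLmodule.Build F quot_lie
  quot_scaleA quot_scale1 quot_scaleDr quot_scaleDl.

Lemma quot_projZ a x : quot_proj (a *: x) = a *: quot_proj x.
Proof. by rewrite -quot_scaleE. Qed.

Fact quot_proj_is_linear : linear quot_proj.
Proof. by move=> a x y; rewrite quot_projD quot_projZ. Qed.
HB.instance Definition _ :=
  GRing.isLinear.Build F g quot_lie _ quot_proj quot_proj_is_linear.

Fact quot_bracket_bilinear : bilinear_for *:%R *:%R quot_bracket.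
Proof.
split=> z a x y; rewrite -(quot_proj_repr x) -(quot_proj_repr y)
  -(quot_proj_repr z) -linearP !quot_bracketE -linearP.
- by rewrite linearPl.
- by rewrite linearPr.
Qed.
Fact quot_bracketxx x : quot_bracket x x = 0.
Proof. by rewrite -(quot_proj_repr x) quot_bracketE liexx linear0. Qed.
Fact quot_bracket_jacobi x y z :
  quot_bracket x (quot_bracket y z) + quot_bracket y (quot_bracket z x)
    + quot_bracket z (quot_bracket x y) = 0.
Proof.
rewrite -(quot_proj_repr x) -(quot_proj_repr y) -(quot_proj_repr z).
by rewrite !quot_bracketE -!linearD lie_jacobi linear0.
Qed.
HB.instance Definition _ := Lmodule_isLieAlgebra.Build F quot_lie
  quot_bracket_bilinear quot_bracketxx quot_bracket_jacobi.

Lemma quot_proj_lie x y : quot_proj (lie x y) = lie (quot_proj x) (quot_proj y).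
Proof. by rewrite -quot_bracketE. Qed.

End QuotientLie.

Lemma jacobi_sum0 (U : zmodType) (a b c d e f : U) :
  a - b - (c - d) + (c - e - (f - b)) + (f - d - (a - e)) = 0.
Proof.
rewrite !opprB [LHS](AC ((2*2)*(2*2)*(2*2))
  ((1*12)*(7*2)*(3*10)*(5*4)*(11*6)*(9*8))).
by rewrite /= !subrr !addr0.
Qed.

Section GLMatrix.
Variables (F : fieldType) (n : nat).

Definition gl_mx_bracket (a b : 'M[F]_n) : 'M[F]_n := a *m b - b *m a.

Fact gl_mx_bilinear : bilinear_for *:%R *:%R gl_mx_bracket.
Proof.
split=> z a x y; rewrite /gl_mx_bracket mulmxDl mulmxDr.
  by rewrite -scalemxAl -scalemxAr opprD addrACA -scalerBr.
by rewrite -scalemxAl -scalemxAr opprD addrACA -scalerBr.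
Qed.
Fact gl_mx_xx x : gl_mx_bracket x x = 0.
Proof. exact: subrr. Qed.
Fact gl_mx_jacobi x y z :
  gl_mx_bracket x (gl_mx_bracket y z) + gl_mx_bracket y (gl_mx_bracket z x)
    + gl_mx_bracket z (gl_mx_bracket x y) = 0.
Proof.
rewrite /gl_mx_bracket !(mulmxBl, mulmxBr) !mulmxA; exact: jacobi_sum0.
Qed.
HB.instance Definition _ := Lmodule_isLieAlgebra.Build F 'M[F]_n
  gl_mx_bilinear gl_mx_xx gl_mx_jacobi.
End GLMatrix.

Section GLVector.
Variables (F : fieldType) (V : vectType F).

Definition gl_bracket (x y : 'End(V)) : 'End(V) := (x \o y)%VF - (y \o x)%VF.

Lemma gl_bracketE x y v : gl_bracket x y v = x (y v) - y (x v).
Proof. by rewrite /gl_bracket add_lfunE opp_lfunE !comp_lfunE. Qed.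

Fact gl_bilinear : bilinear_for *:%R *:%R gl_bracket.
Proof.
by split=> z a x y; apply/lfunP => v;
  rewrite /gl_bracket !(add_lfunE, opp_lfunE, scale_lfunE, comp_lfunE) linearP;
  rewrite scalerBr opprD addrACA.
Qed.
Fact gl_xx x : gl_bracket x x = 0.
Proof. exact: subrr. Qed.
Fact gl_jacobi x y z :
  gl_bracket x (gl_bracket y z) + gl_bracket y (gl_bracket z x)
    + gl_bracket z (gl_bracket x y) = 0.
Proof.
apply/lfunP => v; rewrite zero_lfunE /gl_bracket.
rewrite !(add_lfunE, opp_lfunE, comp_lfunE) !linearB /=.
rewrite -!opprD; exact: jacobi_sum0.
Qed.
HB.instance Definition _ := Lmodule_isLieAlgebra.Build F 'End(V)
  gl_bilinear gl_xx gl_jacobi.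

Lemma lie_glE (x y : 'End(V)) v : lie x y v = x (y v) - y (x v).
Proof. exact: gl_bracketE. Qed.
End GLVector.

Section FormLie.
Variables (F : fieldType) (V : vectType F) (f : {biscalar V}).
Let b : (\dim {:V}).-tuple V := vbasis {:V}.

(** [form_lie_space] is [L(f)], by [form_lie_spaceP]: vanishing of
    [f (x v) w + f v (x w)] is only tested on a basis. *)
Definition form_defect (x : 'End(V)) : 'M[F]_(\dim {:V}) :=
  \matrix_(i, j) (f (x b`_i) b`_j + f b`_i (x b`_j)).

Fact form_defect_is_linear : linear form_defect.
Proof.
move=> a x y; apply/matrixP=> i j; rewrite !mxE.
rewrite !add_lfunE !scale_lfunE linearPl linearPr /=.
by rewrite addrACA -mulrDr.
Qed.
HB.instance Definition _ :=
  GRing.isLinear.Build F 'End(V) 'M[F]_(\dim {:V}) _ form_defect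
    form_defect_is_linear.

Definition form_lie_space : {vspace 'End(V)} := lker (linfun form_defect).

Lemma form_lie_spaceP (x : 'End(V)) :
  reflect (forall v w, f (x v) w = - f v (x w)) (x \in form_lie_space).
Proof.
rewrite memv_ker lfunE; apply: (iffP eqP) => [/matrixP x0 v w|xf]; last first.
  by apply/matrixP => i j; rewrite !mxE xf addNr.
apply/eqP; rewrite -addr_eq0 (coord_vbasis (memvf w)) (linear_sum x).
rewrite !linear_sumr -big_split big1 //= => j _.
rewrite (coord_vbasis (memvf v)) (linear_sum x).
rewrite !linear_sumlz -big_split big1 //= => i _.
rewrite !linearZ /= !linearZl_LR /= -!mulrDr.
by have := x0 i j; rewrite !mxE /b => ->; rewrite !mulr0.
Qed.

Lemma form_lie_space_closed x y :
  x \in form_lie_space -> y \in form_lie_space -> lie x y \in form_lie_space.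
Proof.
move=> /form_lie_spaceP xf /form_lie_spaceP yf; apply/form_lie_spaceP => v w.
by rewrite !lie_glE linearBl linearBr /= !(xf, yf) !opprK opprB.
Qed.

Definition form_lie := subvs_of form_lie_space.
HB.instance Definition _ := Vector.on form_lie.

Definition form_bracket (x y : form_lie) : form_lie :=
  vsproj form_lie_space (lie (vsval x) (vsval y)).

Lemma form_bracketE x y : vsval (form_bracket x y) = lie (vsval x) (vsval y).
Proof. by rewrite vsprojK // form_lie_space_closed ?subvsP. Qed.

Fact form_bilinear : bilinear_for *:%R *:%R form_bracket.
Proof.
split=> z a x y; apply: subvs_inj; rewrite [RHS]linearP /= !form_bracketE.
  by rewrite linearP linearPl.
by rewrite !linearP.
Qed.
Fact form_xx x : form_bracket x x = 0.
Proof. by apply: subvs_inj; rewrite form_bracketE liexx linear0. Qed.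
Fact form_jacobi x y z :
  form_bracket x (form_bracket y z) + form_bracket y (form_bracket z x)
    + form_bracket z (form_bracket x y) = 0.
Proof. by apply: subvs_inj; rewrite !linearD /= !form_bracketE lie_jacobi. Qed.
HB.instance Definition _ := Lmodule_isLieAlgebra.Build F form_lie
  form_bilinear form_xx form_jacobi.

Lemma form_lie_bracket (x y : form_lie) :
  vsval (lie x y) = lie (vsval x) (vsval y).
Proof. exact: form_bracketE. Qed.

End FormLie.

Section FormParts.
Variables (F : fieldType) (V : vectType F) (f : {biscalar V}).

Definition form_plus (u v : V) : F := f u v + f v u.
Definition form_minus (u v : V) : F := f u v - f v u.

Fact form_plus_bilinear : bilinear_for *%R *%R form_plus.
Proof.
by split=> z a x y; rewrite /form_plus linearPl linearPr /= mulrDr addrACA.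
Qed.
HB.instance Definition _ :=
  bilinear_isBilinear.Build F V V F *%R *%R form_plus form_plus_bilinear.

Fact form_minus_bilinear : bilinear_for *%R *%R form_minus.
Proof.
by split=> z a x y;
  rewrite /form_minus linearPl linearPr /= mulrBr opprD addrACA.
Qed.
HB.instance Definition _ :=
  bilinear_isBilinear.Build F V V F *%R *%R form_minus form_minus_bilinear.

(** [v |-> h(-, v)] *)
Definition form_dual1 (h : {biscalar V}) (v : V) : 'Hom(V, F^o) :=
  linfun (applyr h v : V -> F^o).

Lemma form_dual1E (h : {biscalar V}) v u : form_dual1 h v u = h u v.
Proof. by rewrite lfunE. Qed.

Fact form_dual1_is_linear h : linear (form_dual1 h).
Proof.
move=> a x y; apply/lfunP => u.
by rewrite add_lfunE scale_lfunE !form_dual1E linearPr.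
Qed.
HB.instance Definition _ h := GRing.isLinear.Build F V 'Hom(V, F^o) _
  (form_dual1 h) (form_dual1_is_linear h).

Definition form_dual (h : {biscalar V}) : 'Hom(V, 'Hom(V, F^o)) :=
  linfun (form_dual1 h).

(** [sigma_mp] is only meaningful when [form_minus] is non-degenerate, in which
    case [form_dual form_minus] is invertible: see [sigma_mpP] and
    [sigma_mp_unique]. *)
Definition sigma_mp : 'End(V) :=
  ((form_dual form_minus)^-1 \o form_dual form_plus)%VF.

Lemma sigma_mpP :
    (forall v, (forall u, form_minus u v = 0) -> v = 0) ->
  forall u v, form_plus u v = form_minus u (sigma_mp v).
Proof.
move=> ndeg u v.
have ker0 : lker (form_dual form_minus) == 0%VS.
  rewrite -subv0; apply/subvP => w; rewrite memv_ker lfunE /= => /eqP w0.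
  rewrite memv0; apply/eqP/ndeg => t.
  by rewrite -form_dual1E w0 zero_lfunE.
have full : limg (form_dual form_minus) = fullv.
  apply/eqP; rewrite eqEdim subvf limg_dim_eq; last first.
    by apply/eqP; rewrite (eqP ker0) capv0.
  by rewrite !dimvf /dim /= muln1.
rewrite -!form_dual1E comp_lfunE.
set w := form_dual form_plus v.
have -> : form_dual1 form_minus ((form_dual form_minus)^-1%VF w) = w.
  by rewrite -[LHS]lfunE limg_lfunVK ?full ?memvf.
by have -> : w = form_dual1 form_plus v by exact: lfunE.
Qed.

Lemma sigma_mp_unique (s : 'End(V)) :
    (forall v, (forall u, form_minus u v = 0) -> v = 0) ->
  (forall u v, form_plus u v = form_minus u (s v)) -> s = sigma_mp.
Proof.
move=> ndeg sP; apply/lfunP => v; apply/eqP; rewrite -subr_eq0.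
apply/eqP/ndeg => u; rewrite linearBr /= -sP -sigma_mpP //.
exact: subrr.
Qed.

End FormParts.

Section Kernel.
Variables (F : fieldType) (V : vectType F) (f : {biscalar V}) (W : {vspace V}).

(** [form_lie_annihil] consists of the [x] with [x V <= W] and [x W = 0], by
    [form_lie_annihilP]; [projv W] projects onto [W]. *)
Definition annihil_map1 (x : form_lie f) : 'End(V) :=
  ((\1 - projv W) \o vsval x)%VF.
Definition annihil_map2 (x : form_lie f) : 'End(V) := (vsval x \o projv W)%VF.

Fact annihil_map1_is_linear : linear annihil_map1.
Proof.
by move=> a x y; rewrite /annihil_map1 linearP comp_lfunDr comp_lfunZr.
Qed.
HB.instance Definition _ := GRing.isLinear.Build F (form_lie f) 'End(V) _
  annihil_map1 annihil_map1_is_linear.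
Fact annihil_map2_is_linear : linear annihil_map2.
Proof.
by move=> a x y; rewrite /annihil_map2 linearP comp_lfunDl comp_lfunZl.
Qed.
HB.instance Definition _ := GRing.isLinear.Build F (form_lie f) 'End(V) _
  annihil_map2 annihil_map2_is_linear.

Definition form_lie_annihil : {vspace form_lie f} :=
  (lker (linfun annihil_map1) :&: lker (linfun annihil_map2))%VS.

Lemma form_lie_annihilP (x : form_lie f) :
  reflect ((forall v, vsval x v \in W) /\ {in W, forall w, vsval x w = 0})
          (x \in form_lie_annihil).
Proof.
rewrite memv_cap !memv_ker !lfunE; apply: (iffP andP) => /=.
  case=> /eqP x1 /eqP x2; split=> [v|w wW].
    have /lfunP/(_ v) := x1; rewrite comp_lfunE add_lfunE opp_lfunE id_lfunE.
    by rewrite zero_lfunE => /eqP; rewrite subr_eq0 => /eqP ->; apply: memv_proj.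
  have /lfunP/(_ w) := x2; rewrite comp_lfunE zero_lfunE.
  by rewrite projv_id.
case=> xW x0; split; apply/eqP/lfunP => v; rewrite comp_lfunE zero_lfunE.
  by rewrite add_lfunE opp_lfunE id_lfunE projv_id ?subrr.
by rewrite x0 ?memv_proj.
Qed.

End Kernel.

Section Gram.
Variable F : fieldType.

Definition jordan_block (n : nat) (a : F) : 'M[F]_n :=
  \matrix_(i, j) (a *+ (i == j) + ((i : nat) == j.+1)%:R).

Definition gram_A (n : nat) (a : F) : 'M[F]_(n + n) :=
  block_mx 0 1%:M (jordan_block n a) 0.
End Gram.

Section Tensor.
Variables (F : fieldType) (U W : vectType F).

Local Notation bU := (vbasis {:U}).
Local Notation bW := (vbasis {:W}).

(** The tensor product in coordinates: the entry [(i, j)] is the coefficient of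
    [bU`_i ⊗ bW`_j], and [tens_pure u w] is [u ⊗ w].  The universal property is
    given by [tens_liftE] and [tens_ext]. *)
Definition tens := 'M[F]_(\dim {:U}, \dim {:W}).
HB.instance Definition _ := Vector.on tens.

Definition tens_pure (u : U) (w : W) : tens :=
  \matrix_(i, j) (coord bU i u * coord bW j w).

Fact tens_pure_bilinear : bilinear_for *:%R *:%R tens_pure.
Proof.
split=> z a x y; apply/matrixP => i j; rewrite !mxE linearP /=.
  by rewrite mulrDl mulrA.
by rewrite mulrDr mulrCA.
Qed.
HB.instance Definition _ := bilinear_isBilinear.Build F U W tens *:%R *:%R
  tens_pure tens_pure_bilinear.

Definition tens_lift (T : lmodType F) (b : U -> W -> T) (x : tens) : T :=
  \sum_i \sum_j x i j *: b bU`_i bW`_j.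

Fact tens_lift_is_linear (T : lmodType F) b : linear (@tens_lift T b).
Proof.
move=> a x y; rewrite /tens_lift scaler_sumr -big_split; apply: eq_bigr => i _.
rewrite scaler_sumr -big_split; apply: eq_bigr => j _ /=.
by rewrite !mxE scalerDl scalerA.
Qed.
HB.instance Definition _ (T : lmodType F) b := GRing.isLinear.Build F tens T _
  (@tens_lift T b) (@tens_lift_is_linear T b).

Lemma tens_liftE (T : lmodType F) (b : {bilinear U -> W -> T}) u w :
  tens_lift b (tens_pure u w) = b u w.
Proof.
rewrite [in RHS](coord_vbasis (memvf u)) linear_sumlz; apply: eq_bigr => i _.
rewrite [in RHS](coord_vbasis (memvf w)) linear_sumr; apply: eq_bigr => j _.
by rewrite linearZr_LR linearZl_LR /= scalerA mulrC mxE.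
Qed.

Lemma tens_sum (x : tens) :
  x = \sum_i \sum_j x i j *: tens_pure bU`_i bW`_j.
Proof.
rewrite {1}(matrix_sum_delta x); apply: eq_bigr => i _; apply: eq_bigr => j _.
congr (_ *: _); apply/matrixP => k l; rewrite !mxE.
by rewrite !coord_free ?(basis_free (vbasisP _)) // -natrM mulnb eq_sym [l == j]eq_sym.
Qed.

Lemma tens_ind (P : tens -> Prop) : P 0 ->
  (forall x y, P x -> P y -> P (x + y)) -> (forall u w, P (tens_pure u w)) ->
  forall x, P x.
Proof.
move=> P0 PD Pp x; rewrite (tens_sum x); apply: big_ind => // i _.
by apply: big_ind => // j _; rewrite -linearZl_LR; apply: Pp.
Qed.

Lemma tens_ext (T : lmodType F) (h1 h2 : {linear tens -> T}) :
  (forall u w, h1 (tens_pure u w) = h2 (tens_pure u w)) -> h1 =1 h2.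
Proof.
move=> eqh; apply: tens_ind => [|x y hx hy|//]; first by rewrite !linear0.
by rewrite !linearD hx hy.
Qed.

End Tensor.

Arguments tens {F} U W.

Section Current.
Variables (F : fieldType) (g : finLieAlgType F) (k : nat).

(** For [k > 0] this is [F[X]/(X^k)]; for [k = 0], [{poly %/ 'X^0}] is by
    convention [{poly %/ 'X}]. *)
Notation A := {poly %/ ('X^k : {poly F})}.

Definition current := tens g A.
HB.instance Definition _ := Vector.on current.

Definition current_pure_bracket (a : g) (p : A) (b : g) (q : A) : current :=
  tens_pure (lie a b) (p * q).

Fact current_pure_bracket_bilinear a p :
  bilinear_for *:%R *:%R (current_pure_bracket a p).
Proof.
split=> z c x y; rewrite /current_pure_bracket.
  by rewrite linearPr linearPl.
by rewrite mulrDr -scalerAr linearPr.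
Qed.
HB.instance Definition _ a p := bilinear_isBilinear.Build F g A current
  *:%R *:%R (current_pure_bracket a p) (current_pure_bracket_bilinear a p).

Definition current_half_bracket (y : current) (a : g) (p : A) : current :=
  tens_lift (current_pure_bracket a p) y.

Lemma current_half_bracketE a p b q :
  current_half_bracket (tens_pure b q) a p = tens_pure (lie a b) (p * q).
Proof. exact: tens_liftE. Qed.

Fact current_half_bracket_linear a p :
  linear (fun y => current_half_bracket y a p).
Proof. by move=> c x y; rewrite /current_half_bracket linearP. Qed.

Fact current_half_bracket_bilinear y :
  bilinear_for *:%R *:%R (current_half_bracket y).
Proof.
split=> z c x x'; rewrite /current_half_bracket /tens_lift /= scaler_sumr
  -big_split; apply: eq_bigr => i _; rewrite scaler_sumr -big_split;
  apply: eq_bigr => j _; rewrite /= /current_pure_bracket.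
  by rewrite linearPl linearPl /= scalerDr !scalerA mulrC.
by rewrite mulrDl -scalerAl linearPr /= scalerDr !scalerA mulrC.
Qed.
HB.instance Definition _ y := bilinear_isBilinear.Build F g A current
  *:%R *:%R (current_half_bracket y) (current_half_bracket_bilinear y).

Definition current_bracket (x y : current) : current :=
  tens_lift (current_half_bracket y) x.

(** This determines [current_bracket], by [tens_ext]. *)
Lemma current_bracketE a p b q :
  current_bracket (tens_pure a p) (tens_pure b q) =
  tens_pure (lie a b) (p * q).
Proof. by rewrite /current_bracket tens_liftE /= current_half_bracketE. Qed.

Fact current_bracket_bilinear : bilinear_for *:%R *:%R current_bracket.
Proof.
split=> z c x y; rewrite /current_bracket; first by rewrite linearP.
rewrite /tens_lift /= scaler_sumr -big_split; apply: eq_bigr => i _.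
rewrite scaler_sumr -big_split; apply: eq_bigr => j _ /=.
by rewrite current_half_bracket_linear scalerDr !scalerA mulrC.
Qed.
HB.instance Definition _ := bilinear_isBilinear.Build F current current current
  *:%R *:%R current_bracket current_bracket_bilinear.

Fact current_bracket_skew x y : current_bracket x y + current_bracket y x = 0.
Proof.
elim/tens_ind: x => [|x1 x2 h1 h2|a p].
- by rewrite linear0l linear0r addr0.
- by rewrite linearDl linearDr /= addrACA h1 h2 addr0.
elim/tens_ind: y => [|y1 y2 h1 h2|b q].
- by rewrite linear0l linear0r addr0.
- by rewrite linearDl linearDr /= addrACA h1 h2 addr0.
by rewrite !current_bracketE lie_skew mulrC linearNl addNr.
Qed.

Fact current_bracketxx x : current_bracket x x = 0.
Proof.
elim/tens_ind: x => [|x y hx hy|a p]; first by rewrite linear0l.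
  by rewrite linearDl !linearDr /= hx hy add0r addr0 current_bracket_skew.
by rewrite current_bracketE liexx linear0l.
Qed.

Fact current_bracket_jacobi x y z :
  current_bracket x (current_bracket y z)
    + current_bracket y (current_bracket z x)
    + current_bracket z (current_bracket x y) = 0.
Proof.
have AC3 (u v w u' v' w' : current) :
    u + v + w = 0 -> u' + v' + w' = 0 -> u + u' + (v + v') + (w + w') = 0.
  by move=> h h'; rewrite (addrACA u) (addrACA (u + v)) h h' addr0.
elim/tens_ind: x => [|x1 x2 h1 h2|a p].
- by rewrite !(linear0l, linear0r) /= !addr0.
- by rewrite !(linearDl, linearDr) /=; apply: AC3.
elim/tens_ind: y => [|y1 y2 h1 h2|b q].
- by rewrite !(linear0l, linear0r) /= !addr0.
- by rewrite !(linearDl, linearDr) /=; apply: AC3.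
elim/tens_ind: z => [|z1 z2 h1 h2|c r].
- by rewrite !(linear0l, linear0r) /= !addr0.
- by rewrite !(linearDl, linearDr) /=; apply: AC3.
rewrite !current_bracketE.
have -> : q * (r * p) = p * (q * r) by rewrite mulrA mulrC.
have -> : r * (p * q) = p * (q * r) by rewrite mulrCA (mulrC r).
by rewrite -!linearDl lie_jacobi linear0l.
Qed.

HB.instance Definition _ := Lmodule_isLieAlgebra.Build F current
  current_bracket_bilinear current_bracketxx current_bracket_jacobi.

Lemma lie_current (a b : g) (p q : A) :
  lie (tens_pure a p : current) (tens_pure b q : current) =
  tens_pure (lie a b) (p * q).
Proof. exact: current_bracketE. Qed.

End Current.

(* Main.v *)
Require Import Defs.
From HB Require Import structures.
From mathcomp Require Import all_boot all_order all_algebra.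
From mathcomp Require Import zify ring.
Import GRing.Theory.
Local Open Scope ring_scope.

Set Implicit Arguments.
Unset Strict Implicit.
Unset Printing Implicit Defensive.

(** Split [f] into its symmetric part [f^+] and its alternating part [f^-].
    Since [f^-] is non-degenerate, an endomorphism [x] lies in [L(f)] exactly
    when it commutes with [T = sigma^{-+}] and is skew for [f^-].  The operator
    [T] is itself skew for [f^-], so the adjoint of [p(T)] with
    respect to [f^-] is [p(-T)].

    For the Gram matrix [A_n(-1)] the operator [T] is nilpotent with two Jordan
    blocks of size [n]: there are [u] and [w] with
    [f^-(u, T^k w) = 1] if [k = n - 1] and [0] otherwise, such that
    [F[T]u] and [F[T]w] are isotropic ([hyperbolic_pair]).  The pairing shows
    that [V] is free on [u], [w] over [R = F[X]/(X^n)], [X] acting as [T]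
    ([hcoord_span]); hence the centralizer of [T] is the ring of 2 x 2 matrices
    over [R] ([opmx_surj]).  As [n] is odd, [f^-(u, T^{n-1} w)] and
    [f^-(w, T^{n-1} u)] are opposite, and skewness for [f^-] says that the
    off-diagonal entries are even in [X] and that the diagonal is
    [(a, -a(-X))] ([opmx_skewP]).  Splitting [a] into its even
    and odd parts,

      L(f) = sl_2(F[X^2]/(X^{n+1}))  +  X F[X^2]/(X^n) . 1,

    a direct sum in which the second summand is central.  As 2 is invertible,
    the trace splits [gl_2] over [F[X^2]/(X^{n+1})] into [sl_2] and scalars;
    sending a traceless matrix to itself and a scalar [s] to [X s] gives a
    morphism of Lie algebras onto [L(f)], whose kernel is spanned by the scalar
    [X^{n-1}] because [X^n = 0] ([current_to_form_morph],
    [current_to_form_surj], [current_to_form_ker]).  Here [X^2] plays the role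
    of the variable of the current algebra, truncated at order [(n + 1)/2].
    The isomorphism and the dimension follow.

    The subspace [K] is an ideal because [L(f)] preserves [ker T], and it is
    abelian because the product of two of its elements is zero.  For [n > 1]
    it contains [X^{n-1}] times the matrix unit [E_01], which does not commute
    with [E_10]; so [K] is a solvable ideal outside the center and [L(f)] is not
    reductive.  For [n = 1] the algebra is spanned by an [sl_2]-triple, hence
    has no proper non-zero ideal and is perfect. *)

(** * The action of polynomials in an endomorphism *)

Section PolynomialAction.
Variables (F : fieldType) (V : vectType F) (T : 'End(V)).
Implicit Types (p q : {poly F}) (v : V).

Definition polyact p v : V := \sum_(i < size p) p`_i *: iter i T v.

(** Polynomials of different sizes are compared through a common summation
    range. *)
Lemma polyact_wide m p v : (size p <= m)%N ->
  polyact p v = \sum_(i < m) p`_i *: iter i T v.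
Proof.
move=> sp; rewrite /polyact (big_ord_widen m (fun i => p`_i *: iter i T v) sp).
rewrite big_mkcond; apply: eq_bigr => i _ /=; case: ltnP => // szp.
by rewrite nth_default // scale0r.
Qed.

Lemma iter_linearP k a x y :
  iter k T (a *: x + y) = a *: iter k T x + iter k T y.
Proof. by elim: k => //= k ->; rewrite linearP. Qed.

Fact polyact_bilinear : bilinear_for *:%R *:%R polyact.
Proof.
split=> z a x y.
  set m := maxn (size x) (size y).
  have sx : (size x <= m)%N by rewrite leq_maxl.
  have sy : (size y <= m)%N by rewrite leq_maxr.
  have sxy : (size (a *: x + y)%R <= m)%N.
    rewrite (leq_trans (size_polyD _ _)) // geq_max sy andbT.
    exact: leq_trans (size_scale_leq _ _) sx.
  rewrite (polyact_wide z sx) (polyact_wide z sy) (polyact_wide z sxy) /=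
    scaler_sumr.
  rewrite -big_split; apply: eq_bigr => i _ /=.
  by rewrite coefD coefZ scalerDl scalerA.
rewrite /polyact /= scaler_sumr -big_split; apply: eq_bigr => i _ /=.
by rewrite iter_linearP scalerDr !scalerA mulrC.
Qed.
HB.instance Definition _ := bilinear_isBilinear.Build F {poly F} V V
  *:%R *:%R polyact polyact_bilinear.

Lemma polyactC a v : polyact a%:P v = a *: v.
Proof. by rewrite (@polyact_wide 1) ?size_polyC_leq1 // big_ord1 coefC. Qed.

Lemma polyact1 v : polyact 1 v = v.
Proof. by rewrite -[1]/(1%:P) polyactC scale1r. Qed.

Lemma polyactXn k v : polyact 'X^k v = iter k T v.
Proof.
rewrite (@polyact_wide k.+1) ?size_polyXn // big_ord_recr /= coefXn eqxx
  scale1r.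
by rewrite big1 ?add0r // => i _; rewrite coefXn ltn_eqF // scale0r.
Qed.

Lemma polyactX v : polyact 'X v = T v. Proof. exact: (polyactXn 1). Qed.

Lemma polyactMX p v : polyact (p * 'X) v = T (polyact p v).
Proof.
rewrite (@polyact_wide (size p).+1); last first.
  by rewrite (leq_trans (size_polyMleq _ _)) // size_polyX addn2.
rewrite big_ord_recl coefMX scale0r add0r /polyact linear_sum.
by apply: eq_bigr => i _; rewrite coefMX /= linearZ.
Qed.

Lemma polyactM p q v : polyact (p * q) v = polyact p (polyact q v).
Proof.
elim/poly_ind: p => [|p c IH]; first by rewrite mul0r !linear0l.
by rewrite mulrDl mulrAC !linearDl /= !polyactMX IH mul_polyC linearZl_LR
  polyactC.
Qed.

Lemma polyact_comm (x : 'End(V)) : (forall v, x (T v) = T (x v)) ->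
  forall p v, x (polyact p v) = polyact p (x v).
Proof.
move=> xT p v; rewrite /polyact linear_sum; apply: eq_bigr => i _.
rewrite linearZ; congr (_ *: _).
by elim: (i : nat) => //= k IH; rewrite xT IH.
Qed.

End PolynomialAction.

(** * A module with a hyperbolic pair of cyclic vectors *)

Lemma sum_ord2 (M : nmodType) (G : 'I_2 -> M) : \sum_i G i = G 0 + G 1.
Proof.
by rewrite !big_ord_recl big_ord0 addr0; congr (G _ + G _); apply: val_inj.
Qed.

Lemma ord2_ind (P : 'I_2 -> Prop) : P 0 -> P 1 -> forall i, P i.
Proof.
by move=> P0 P1 [[|[|//]] ?]; [move: P0 | move: P1]; congr P; apply: val_inj.
Qed.

(** The pairings of one generator with [T^(n-1)] applied to another; the square
    of this matrix is [-1], so it also recovers coordinates from pairings. *)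
Definition symplectic2 (F : fieldType) : 'M[F]_2 :=
  \matrix_(i, j) (if i == j then 0 else (-1) ^+ i).

Lemma symplectic2_sqr (F : fieldType) (i l : 'I_2) :
  \sum_j symplectic2 F i j * symplectic2 F j l = - (i == l)%:R.
Proof.
move: i l; apply: ord2_ind; apply: ord2_ind;
  rewrite sum_ord2 !mxE /= ?expr1 ?expr0 ?mulr0 ?mul0r ?mulr1 ?mul1r ?add0r
    ?addr0 ?oppr0 //.
Qed.

Section HyperbolicPair.
Variables (F : fieldType) (V : vectType F) (h : {biscalar V}) (T : 'End(V)).
Variables (n : nat) (b : 'I_2 -> V).
Hypothesis T_skew : forall x y, h (T x) y = - h x (T y).
Hypothesis b_gram : forall i j k,
  h (b i) (iter k T (b j)) = symplectic2 F i j * (k == n.-1)%:R.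
Hypothesis n_gt0 : (0 < n)%N.
Hypothesis dimV : \dim {:V} = (2 * n)%N.
Implicit Types (p q : {poly F}) (v w : V) (A B : 'M[{poly F}]_2).
Local Notation J := (symplectic2 F).

(** Skewness of [T] turns the adjoint of [p(T)] into [p(-T)]. *)
Lemma polyact_adj p v w : h (polyact T p v) w = h v (polyact T (p \Po - 'X) w).
Proof.
elim/poly_ind: p v w => [|p c IH] v w.
  by rewrite comp_poly0 !linear0l linear0r.
rewrite comp_polyD comp_polyM comp_polyX comp_polyC !linearDl linearDr /=.
rewrite !polyactC linearZl_LR linearZr_LR; congr (_ + _).
by rewrite polyactMX T_skew IH mulrN linearNl linearNr /= polyactMX
  polyact_comm.
Qed.

Lemma gram_polyact i j p : h (b i) (polyact T p (b j)) = J i j * p`_n.-1.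
Proof.
rewrite (@polyact_wide _ _ _ (maxn n (size p))) ?leq_maxr // linear_sumr /=.
have hn : (n.-1 < maxn n (size p))%N by rewrite prednK // leq_maxl.
rewrite (bigD1 (Ordinal hn)) //= big1 ?addr0 => [|k ne].
  by rewrite linearZr_LR /= b_gram eqxx mulr1 mulrC.
rewrite linearZr_LR /= b_gram (_ : (k : nat) == n.-1 = false) ?mulr0 //.
by apply: contraNF ne => /eqP kn; apply/eqP/val_inj.
Qed.

(** The coefficient of [T^k (b i)] in [v] is read off by pairing [T^(n-1-k) v]
    with the other vector of the pair; the sign comes from
    [symplectic2_sqr]. *)
Definition hcoord i v : {poly F} :=
  \poly_(k < n) - \sum_j J i j * h (b j) (iter (n.-1 - k) T v).

Fact hcoord_is_linear i : linear (hcoord i).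
Proof.
move=> a x y; apply/polyP => k; rewrite coefD coefZ !coef_poly.
case: ifP => _; last by rewrite mulr0 addr0.
rewrite mulrN mulr_sumr -opprD -big_split; congr (- _);
  apply: eq_bigr => j _ /=.
by rewrite iter_linearP linearPr /= mulrDr mulrCA.
Qed.
HB.instance Definition _ i :=
  GRing.isLinear.Build F V {poly F} _ (hcoord i) (hcoord_is_linear i).

Lemma hcoord_polyact i l p :
  hcoord i (polyact T p (b l)) = if i == l then take_poly n p else 0.
Proof.
apply/polyP => k; rewrite coef_poly.
have [kn|nk] := ltnP k n; last first.
  by case: ifP => _; rewrite ?coef0 // coef_take_poly ltnNge nk.
transitivity ((i == l)%:R * p`_k); last first.
  by case: ifP; rewrite ?mul1r ?mul0r ?coef0 // coef_take_poly kn.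
rewrite -[(i == l)%:R]opprK -symplectic2_sqr mulNr mulr_suml.
congr (- _); apply: eq_bigr => j _.
rewrite -polyactXn -polyactM gram_polyact coefXnM ltnNge leq_subr /= subKn
  ?mulrA //.
by rewrite -ltnS prednK.
Qed.

Let synth (M : 'M[F]_(2, n)) : V := \sum_i polyact T (rVpoly (row i M)) (b i).

Fact synth_is_linear : linear synth.
Proof.
move=> a x y; rewrite /synth scaler_sumr -big_split; apply: eq_bigr => i _ /=.
by rewrite !linearP linearPl.
Qed.
HB.instance Definition _ :=
  GRing.isLinear.Build F 'M[F]_(2, n) V _ synth synth_is_linear.

Lemma hcoord_synth i M : hcoord i (synth M) = rVpoly (row i M).
Proof.
rewrite linear_sum (bigD1 i) //= hcoord_polyact eqxx take_poly_id ?size_poly //.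
by rewrite big1 ?addr0 // => j ji; rewrite hcoord_polyact eq_sym (negPf ji).
Qed.

(** The map from coordinates to [V] is injective, because [hcoord] is a left
    inverse, and [V] has dimension [2n]; so it is onto. *)
Lemma hcoord_span v : v = \sum_i polyact T (hcoord i v) (b i).
Proof.
have ker0 : lker (linfun synth) == 0%VS.
  rewrite -subv0; apply/subvP => M; rewrite memv_ker lfunE /= => /eqP M0.
  rewrite memv0; apply/eqP/row_matrixP => i.
  by rewrite -[row i M]rVpolyK -hcoord_synth M0 !linear0.
have full : limg (linfun synth) = fullv.
  apply/eqP; rewrite eqEdim subvf limg_dim_eq; last first.
    by apply/eqP; rewrite (eqP ker0) capv0.
  by rewrite dimV dimvf /dim /= leqnn.
have /memv_imgP[M _ ->] : v \in limg (linfun synth) by rewrite full memvf.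
by rewrite lfunE /=; apply: eq_bigr => i _; rewrite hcoord_synth.
Qed.

(** Nilpotency follows from the pairing alone: all coordinates of
    [T^n (b i)] vanish. *)
Lemma polyact_Xn_b i : iter n T (b i) = 0.
Proof.
rewrite [LHS]hcoord_span big1 // => j _; rewrite -polyactXn hcoord_polyact.
by case: ifP; rewrite ?linear0l // -['X^n]mul1r take_polyMXn_0 linear0l.
Qed.

Lemma polyact_take p i : polyact T (take_poly n p) (b i) = polyact T p (b i).
Proof.
rewrite -{2}(poly_take_drop n p) linearDl /= polyactM polyactXn polyact_Xn_b.
by rewrite linear0r addr0.
Qed.

Lemma hyperbolic_ext (x y : 'End(V)) :
  (forall p j, x (polyact T p (b j)) = y (polyact T p (b j))) -> x = y.
Proof.
move=> xy; apply/lfunP => v; rewrite [v]hcoord_span !linear_sum.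
by apply: eq_bigr => i _; apply: xy.
Qed.

(** The matrix [A] acts on coordinate columns; only its entries modulo [X^n]
    matter, see [opmx_eq]. *)
Definition opmx_fun A v := \sum_i polyact T (\sum_j A i j * hcoord j v) (b i).

Fact opmx_is_linear A : linear (opmx_fun A).
Proof.
move=> a x y; rewrite /opmx_fun scaler_sumr -big_split;
  apply: eq_bigr => i _ /=.
rewrite -linearZl_LR -linearDl /= scaler_sumr -big_split; congr polyact.
by apply: eq_bigr => j _ /=; rewrite linearP mulrDr scalerAr.
Qed.
HB.instance Definition _ A :=
  GRing.isLinear.Build F V V _ (opmx_fun A) (opmx_is_linear A).

Definition opmx A : 'End(V) := linfun (opmx_fun A).

Lemma opmx_polyact A p j :
  opmx A (polyact T p (b j)) = \sum_i polyact T (A i j * p) (b i).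
Proof.
rewrite lfunE; apply: eq_bigr => i _ /=.
rewrite (bigD1 j) //= hcoord_polyact eqxx big1 => [|l lj]; last first.
  by rewrite hcoord_polyact (negPf lj) mulr0.
by rewrite addr0 !polyactM polyact_take.
Qed.

Lemma opmx_b A j : opmx A (b j) = \sum_i polyact T (A i j) (b i).
Proof.
by rewrite -{1}[b j](polyact1 T) opmx_polyact; under eq_bigr do rewrite mulr1.
Qed.

Lemma opmxD A B : opmx (A + B) = opmx A + opmx B.
Proof.
apply: hyperbolic_ext => p j; rewrite add_lfunE !opmx_polyact -big_split.
by apply: eq_bigr => i _; rewrite mxE mulrDl linearDl.
Qed.

Lemma opmxB A B : opmx (A - B) = opmx A - opmx B.
Proof.
apply: hyperbolic_ext => p j.
rewrite add_lfunE opp_lfunE !opmx_polyact -sumrN -big_split.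
by apply: eq_bigr => i _; rewrite !mxE mulrBl linearBl.
Qed.

Lemma opmxZ a A : opmx (a%:P *: A) = a *: opmx A.
Proof.
apply: hyperbolic_ext => p j; rewrite scale_lfunE !opmx_polyact scaler_sumr.
by apply: eq_bigr => i _; rewrite mxE -mulrA mul_polyC linearZl_LR.
Qed.

Lemma opmxM A B : opmx (A *m B) = (opmx A \o opmx B)%VF.
Proof.
apply: hyperbolic_ext => p j; rewrite comp_lfunE !opmx_polyact linear_sum /=.
under [RHS]eq_bigr do rewrite opmx_polyact.
rewrite exchange_big; apply: eq_bigr => i _ /=.
rewrite -linear_sumlz mxE mulr_suml; congr polyact.
by apply: eq_bigr => k _; rewrite mulrA.
Qed.

Lemma opmx_comm A v : opmx A (T v) = T (opmx A v).
Proof.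
have /lfunP/(_ v) : (opmx A \o T)%VF = (T \o opmx A)%VF.
  apply: hyperbolic_ext => p j;
    rewrite !comp_lfunE -polyactMX !opmx_polyact linear_sum.
  by apply: eq_bigr => i _; rewrite mulrA polyactMX.
by rewrite !comp_lfunE.
Qed.

Lemma hcoord_opmx A i j : hcoord i (opmx A (b j)) = take_poly n (A i j).
Proof.
rewrite opmx_b linear_sum (bigD1 i) //= hcoord_polyact eqxx big1 ?addr0 // => l
  li.
by rewrite hcoord_polyact eq_sym (negPf li).
Qed.

Lemma opmx_eq A B : reflect
  (forall i j, take_poly n (A i j) = take_poly n (B i j)) (opmx A == opmx B).
Proof.
apply: (iffP eqP) => [AB i j|AB]; first by rewrite -!hcoord_opmx AB.
apply: hyperbolic_ext => p j; rewrite !opmx_polyact; apply: eq_bigr => i _.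
by rewrite mulrC !polyactM -polyact_take AB polyact_take -!polyactM mulrC.
Qed.

(** An endomorphism commuting with [T] is [F[T]]-linear, hence determined by
    the coordinates of the images of the two generators. *)
Lemma opmx_surj (x : 'End(V)) : (forall v, x (T v) = T (x v)) ->
  x = opmx (\matrix_(i, j) hcoord i (x (b j))).
Proof.
move=> xT; apply: hyperbolic_ext => p j; rewrite polyact_comm // opmx_polyact.
rewrite {1}[x (b j)]hcoord_span linear_sumr; apply: eq_bigr => i _ /=.
by rewrite mxE -polyactM mulrC.
Qed.

Lemma coef_comp_opp p k : (p \Po - 'X)`_k = (-1) ^+ k * p`_k.
Proof.
elim/poly_ind: p k => [|p c IH] k; first by rewrite comp_poly0 coef0 mulr0.
rewrite comp_polyD comp_polyM comp_polyX comp_polyC !coefD mulrN coefN !coefC.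
rewrite !coefMX; case: k => [|k] /=; first by rewrite oppr0 !add0r mul1r.
by rewrite !addr0 IH exprS mulN1r mulNr.
Qed.

(** For fixed [j] and [l] the pairings with all powers [T^k (b l)] isolate the
    coefficients one by one, and conversely every pairing is a combination of
    these by [polyact_adj]. *)
Lemma opmx_skewP A :
  (forall v w, h (opmx A v) w = - h v (opmx A w)) <->
  forall j l k, (k < n)%N ->
    \sum_i J i l * ((-1) ^+ k * (A i j)`_k) = - \sum_i J j i * (A i l)`_k.
Proof.
have lhs j l q : h (opmx A (b j)) (polyact T q (b l)) =
    \sum_i J i l * ((A i j \Po - 'X) * q)`_n.-1.
  rewrite opmx_b linear_sumlz; apply: eq_bigr => i _.
  by rewrite /= polyact_adj -polyactM gram_polyact.
have rhs j l q : h (b j) (opmx A (polyact T q (b l))) =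
    \sum_i J j i * (A i l * q)`_n.-1.
  by rewrite opmx_polyact linear_sumr; apply: eq_bigr => i _;
    rewrite /= gram_polyact.
split=> [sk j l k kn|sk].
  have := sk (b j) (polyact T 'X^(n.-1 - k) (b l)); rewrite lhs rhs.
  under eq_bigr do rewrite coefMXn ltnNge leq_subr /= subKn
    ?coef_comp_opp -1?ltnS ?prednK //.
  by under [X in _ = - X]eq_bigr do rewrite coefMXn ltnNge leq_subr /= subKn
    -1?ltnS ?prednK //.
have base j l q : h (opmx A (b j)) (polyact T q (b l)) =
    - h (b j) (opmx A (polyact T q (b l))).
  rewrite lhs rhs; under eq_bigr do rewrite coefM mulr_sumr.
  under [X in _ = - X]eq_bigr do rewrite coefM mulr_sumr.
  rewrite exchange_big [X in _ = - X]exchange_big -sumrN;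
    apply: eq_bigr => k _ /=.
  under eq_bigr do rewrite mulrA coef_comp_opp.
  under [X in _ = - X]eq_bigr do rewrite mulrA.
  by rewrite -!mulr_suml sk ?mulNr // -[n in (_ < n)%N]prednK.
have opA := polyact_comm (opmx_comm A).
move=> v w; rewrite [v]hcoord_span linear_sum !linear_sumlz -sumrN.
apply: eq_bigr => i _ /=; rewrite opA !polyact_adj -opA.
set q := _ \Po _.
have -> : polyact T q w = \sum_j polyact T (q * hcoord j w) (b j).
  by rewrite {1}[w]hcoord_span linear_sumr; apply: eq_bigr => j _;
    rewrite polyactM.
rewrite linear_sumr [opmx A (\sum_j _)]linear_sum linear_sumr -sumrN.
by apply: eq_bigr => j _; rewrite base.
Qed.

End HyperbolicPair.

(** * The Lie algebra of a form and the endomorphism sigma *)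

Section Sigma.
Variables (F : fieldType) (V : vectType F) (f : {biscalar V}).
Hypothesis two_neq0 : 2%:R != 0 :> F.
Hypothesis ndeg : forall v, (forall u, form_minus f u v = 0) -> v = 0.
Local Notation T := (sigma_mp f).

Lemma form_minusC x y : form_minus f x y = - form_minus f y x.
Proof. by rewrite /form_minus opprB. Qed.

Lemma form_plusC x y : form_plus f x y = form_plus f y x.
Proof. exact: addrC. Qed.

Lemma sigma_mp_skew x y : form_minus f (T x) y = - form_minus f x (T y).
Proof. by rewrite form_minusC -!sigma_mpP // form_plusC. Qed.

(** An [x] skew for both [f^-] and [f^+] commutes with [sigma^{-+}] by
    non-degeneracy; conversely skewness for [f^-] and commutation with
    [sigma^{-+}] give skewness for [f^+], and [2 f = f^- + f^+]. *)
Lemma form_lie_sigmaP (x : 'End(V)) : x \in form_lie_space f <->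
  (forall v, x (T v) = T (x v)) /\
  (forall v w, form_minus f (x v) w = - form_minus f v (x w)).
Proof.
split=> [/form_lie_spaceP xf|[xT xm]].
  have xf' v w : f w (x v) = - f (x w) v by rewrite xf opprK.
  have xm v w : form_minus f (x v) w = - form_minus f v (x w).
    by rewrite /form_minus xf (xf' v w) opprB opprK addrC.
  have xp v w : form_plus f (x v) w = - form_plus f v (x w).
    by rewrite /form_plus xf (xf' v w) opprD.
  split=> // v; apply/eqP; rewrite -subr_eq0; apply/eqP/ndeg => u.
  rewrite linearBr /= -sigma_mpP // -[form_minus f u (x _)]opprK -xm -sigma_mpP
    //.
  by rewrite xp opprK subrr.
have xp v w : form_plus f (x v) w = - form_plus f v (x w).
  by rewrite !sigma_mpP // xm xT.
apply/form_lie_spaceP => v w; apply: (mulfI two_neq0); rewrite mulrN.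
have two u u' : 2%:R * f u u' = form_minus f u u' + form_plus f u u'.
  by rewrite /form_minus /form_plus; ring.
by rewrite !two xm xp -opprD.
Qed.

End Sigma.

Section Chain.
Variables (F : fieldType) (V : vectType F) (T : 'End(V)) (n : nat).
Variables (eps : F) (X : nat -> V).
Hypothesis two_neq0 : 2%:R != 0 :> F.
Hypothesis X_chain :
  forall j, T (2%:R *: X j - X j.+1) = eps *: X j.+1.
Hypothesis X_out : forall j, (n <= j)%N -> X j = 0.

Lemma chain_step j : polyact T (2%:R%:P * 'X) (X j) =
  polyact T ('X + eps%:P) (X j.+1).
Proof.
rewrite linearDl /= polyactC polyactMX polyactX polyactC -X_chain linearB addrC
  subrK.
by [].
Qed.

Lemma chain_pow j :
  polyact T (('X + eps%:P) ^+ j) (X j) = polyact T ((2%:R%:P * 'X) ^+ j) (X 0).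
Proof.
elim: j => [|j IH]; first by rewrite !expr0.
rewrite exprSr polyactM -chain_step -polyactM mulrC polyactM IH -polyactM
  -exprS.
by [].
Qed.

(** The relation [2 T X_j = (T + eps) X_{j+1}] moves a power of [2T] on [X_0]
    to a power of [T + eps] on [X_j]; as [X_n = 0] this bounds the order of
    nilpotency of [T] on [X_0], and at [j = n - 1] it computes [T^(n-1) X_0] up
    to a scalar. *)
Lemma chain_iter j :
  2%:R ^+ j *: iter j T (X 0) = polyact T (('X + eps%:P) ^+ j) (X j).
Proof.
by rewrite chain_pow exprMn -polyC_exp mul_polyC linearZl_LR /= polyactXn.
Qed.

Lemma chain_nil : iter n T (X 0) = 0.
Proof.
apply/eqP; have := chain_iter n.
rewrite (X_out (leqnn n)) linear0r => /eqP;
  rewrite scaler_eq0 expf_eq0 (negPf two_neq0).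
by rewrite andbF.
Qed.

Lemma chain_last : (0 < n)%N ->
  2%:R ^+ n.-1 *: iter n.-1 T (X 0) = eps ^+ n.-1 *: X n.-1.
Proof.
move=> n0; rewrite chain_iter.
have TX : T (X n.-1) = 0.
  apply/eqP; have /eqP := X_chain n.-1;
    rewrite prednK // (X_out (leqnn n)) scaler0 subr0.
  by rewrite linearZ scaler_eq0 (negPf two_neq0).
move: (X n.-1) TX => x TX; elim: n.-1 => [|k IH];
  first by rewrite !expr0 polyact1 scale1r.
rewrite 2!exprS polyactM IH linearZr_LR linearDl /= polyactX polyactC TX add0r
  scalerA.
by rewrite mulrC.
Qed.

Definition chain_span : {vspace V} := <<[seq X i | i <- iota 0 n]>>%VS.

Lemma mem_chain_span i : X i \in chain_span.
Proof.
have [lt_in|le_ni] := ltnP i n; last by rewrite X_out // mem0v.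
by apply: memv_span; apply: map_f; rewrite mem_iota.
Qed.

Lemma chain_nth (i : 'I_n) : [seq X i | i <- iota 0 n]`_i = X i.
Proof. by rewrite (nth_map 0%N) ?size_iota ?nth_iota. Qed.

(** Descending induction: [2 T X_j] is [T X_{j+1} + eps X_{j+1}], and
    [X_n = 0]. *)
Lemma chain_span_stable v : v \in chain_span -> T v \in chain_span.
Proof.
suff TX k : (k <= n)%N -> T (X (n - k)) \in chain_span.
  move=> /coord_span ->; rewrite linear_sum; apply: memv_suml => i _.
  rewrite linearZ; apply: rpredZ; rewrite chain_nth.
  by have := TX (n - i)%N (leq_subr _ _); rewrite subKn // ltnW.
elim: k => [|k IH] kn; first by rewrite subn0 X_out // linear0 mem0v.
have := X_chain (n - k.+1); rewrite subnSK // linearB linearZ => /eqP.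
rewrite subr_eq => /eqP eqX.
have -> : T (X (n - k.+1)) = 2%:R^-1 *: (2%:R *: T (X (n - k.+1))).
  by rewrite scalerA mulVf ?scale1r.
by rewrite eqX rpredZ // rpredD ?IH ?rpredZ ?mem_chain_span // ltnW.
Qed.

Lemma chain_span_iter k v : v \in chain_span -> iter k T v \in chain_span.
Proof. by move=> vX; elim: k => //= k; apply: chain_span_stable. Qed.

Lemma chain_span_isotropic (h : {biscalar V}) :
  (forall i j, (i < n)%N -> (j < n)%N -> h (X i) (X j) = 0) ->
  {in chain_span &, forall v w, h v w = 0}.
Proof.
move=> hX v w /coord_span -> /coord_span ->.
rewrite linear_sumlz big1 // => i _; rewrite linear_sumr big1 // => j _ /=.
rewrite linearZl_LR linearZr_LR /=.
by rewrite !chain_nth hX // !mulr0.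
Qed.

End Chain.

(** * A hyperbolic pair for the Gram matrix A_n(-1) *)

Section GramChains.
Variables (F : fieldType) (n : nat) (V : vectType F) (f : {biscalar V}).
Variable e : (n + n).-tuple V.
Hypothesis two_neq0 : 2%:R != 0 :> F.
Hypothesis n_gt0 : (0 < n)%N.
Hypothesis e_basis : basis_of {:V} e.
Hypothesis f_gram : forall i j : 'I_(n + n), f e`_i e`_j = gram_A n (-1) i j.
Local Notation h := (form_minus f).

Definition chainE i := if (i < n)%N then e`_i else 0.
(** The second half of the basis is listed backwards, so that both halves obey
    the same recurrence up to a sign. *)
Definition chainG i := if (i < n)%N then e`_(n + (n.-1 - i)) else 0.

Lemma chainE_out j : (n <= j)%N -> chainE j = 0.
Proof. by rewrite /chainE ltnNge => ->. Qed.
Lemma chainG_out j : (n <= j)%N -> chainG j = 0.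
Proof. by rewrite /chainG ltnNge => ->. Qed.

Lemma chainEE (i : 'I_n) : chainE i = e`_(lshift n i).
Proof. by rewrite /chainE ltn_ord. Qed.
Lemma chainGE (i : 'I_n) : chainG i = e`_(rshift n (rev_ord i)).
Proof. by rewrite /chainG ltn_ord /=; congr (e`_(_ + _)); lia. Qed.

Lemma gram_EE i j : f (chainE i) (chainE j) = 0.
Proof.
have [lt_in|/chainE_out ->] := ltnP i n; last by rewrite linear0l.
have [lt_jn|/chainE_out ->] := ltnP j n; last by rewrite linear0r.
rewrite (chainEE (Ordinal lt_in)) (chainEE (Ordinal lt_jn)) f_gram.
by rewrite block_mxEul mxE.
Qed.

Lemma gram_GG i j : f (chainG i) (chainG j) = 0.
Proof.
have [lt_in|/chainG_out ->] := ltnP i n; last by rewrite linear0l.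
have [lt_jn|/chainG_out ->] := ltnP j n; last by rewrite linear0r.
rewrite (chainGE (Ordinal lt_in)) (chainGE (Ordinal lt_jn)) f_gram.
by rewrite block_mxEdr mxE.
Qed.

Lemma gram_EG i j : f (chainE i) (chainG j) = (i + j == n.-1)%N%:R.
Proof.
have [lt_in|ni] :=
  ltnP i n; last by rewrite chainE_out // linear0l; case: eqP => //; lia.
have [lt_jn|nj] :=
  ltnP j n; last by rewrite chainG_out // linear0r; case: eqP => //; lia.
rewrite (chainEE (Ordinal lt_in)) (chainGE (Ordinal lt_jn)) f_gram.
rewrite block_mxEur mxE -val_eqE /=; congr (_%:R).
by case: eqP => ?; case: eqP => //; lia.
Qed.

Lemma gram_GE i j :
  f (chainG i) (chainE j) = (i + j.+1 == n.-1)%N%:R - (i + j == n.-1)%N%:R.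
Proof.
have [lt_in|ni] := ltnP i n; last first.
  by rewrite chainG_out // linear0l; do 2!(case: eqP; first lia); rewrite subrr.
have [lt_jn|nj] := ltnP j n; last first.
  by rewrite chainE_out // linear0r; do 2!(case: eqP; first lia); rewrite subrr.
rewrite (chainGE (Ordinal lt_in)) (chainEE (Ordinal lt_jn)) f_gram.
rewrite block_mxEdl mxE -val_eqE /= mulNrn addrC.
by congr (_%:R - _%:R); [case: eqP => ?; case: eqP => //; lia | case: eqP => ?;
  case: eqP => //; lia].
Qed.

Lemma minus_EG i j : h (chainE i) (chainG j) =
  2%:R * (i + j == n.-1)%N%:R - (i + j.+1 == n.-1)%N%:R.
Proof.
by rewrite /form_minus gram_EG gram_GE addnC [(j + i.+1)%N]addnC addSnnS; ring.
Qed.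

Lemma plus_EG i j : form_plus f (chainE i) (chainG j) = (i + j.+1 == n.-1)%N%:R.
Proof.
by rewrite /form_plus gram_EG gram_GE addnC [(j + i.+1)%N]addnC addSnnS; ring.
Qed.

(** The coefficients are those of [f^-] between the two chains: up to reversing
    the rows, a triangular matrix with 2 on the diagonal. *)
Lemma bidiag (c : nat -> F) :
  (forall i, \sum_(j < n) c j *
     (2%:R * (i + j == n.-1)%N%:R - (i + j.+1 == n.-1)%N%:R) = 0) ->
  forall j, (j < n)%N -> c j = 0.
Proof.
move=> c0 j; elim/ltn_ind: j => j IH lt_jn.
have := c0 (n.-1 - j)%N; rewrite (bigD1 (Ordinal lt_jn)) //= big1 => [|k kj].
  rewrite addr0 (_ : _ == _); last by apply/eqP; lia.
  rewrite (_ : _ == _ = false); last by apply/eqP; lia.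
  by rewrite mulr1 subr0 => /eqP;
    rewrite mulf_eq0 (negPf two_neq0) orbF => /eqP.
have kj' : k != j :> nat by apply: contraNneq kj => kj; apply/eqP/val_inj.
rewrite (_ : _ == _ = false); last by apply/eqP; lia.
rewrite mulr0 sub0r; case: eqP => [jk|_]; last by rewrite oppr0 mulr0.
by rewrite IH ?mul0r //; lia.
Qed.

(** The two halves of the basis are isotropic for [f^-], so each one only
    detects the coordinates along the other, to which [bidiag] applies. *)
Lemma chains_separate x :
  (forall i, h (chainE i) x = 0) -> (forall i, h (chainG i) x = 0) -> x = 0.
Proof.
pose a j := if insub j is Some i then coord e (lshift n i) x else 0.
pose c j := if insub j is Some i then coord e (rshift n (rev_ord i)) x else 0.
have -> : x = \sum_(j < n) a j *: chainE j + \sum_(j < n) c j *: chainG j.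
  rewrite {1}(coord_basis e_basis (memvf x)) big_split_ord /=; congr (_ + _).
    by apply: eq_bigr => i _; rewrite /a valK chainEE.
  rewrite (reindex_inj rev_ord_inj) /=.
  by apply: eq_bigr => i _; rewrite /c valK chainGE.
move=> xE xG; rewrite !big1 ?addr0 // => j _.
  rewrite (@bidiag c) ?scale0r // => i;
    rewrite -[RHS](xE i) linearDr /= !linear_sumr.
  rewrite [X in _ = X + _]big1 ?add0r => [|k _].
    by apply: eq_bigr => k _; rewrite linearZr_LR /= minus_EG.
  by rewrite linearZr_LR /= /form_minus !gram_EE subrr mulr0.
rewrite (@bidiag a) ?scale0r // => i;
  rewrite -[RHS]oppr0 -[X in _ = - X](xG i) linearDr /= !linear_sumr.
rewrite [X in _ = - (_ + X)]big1 ?addr0 => [|k _].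
  rewrite -sumrN; apply: eq_bigr => k _;
    rewrite linearZr_LR /= form_minusC minus_EG.
  by rewrite mulrN opprK (addnC k i) (addnC k i.+1) addSnnS.
by rewrite linearZr_LR /= /form_minus !gram_GG subrr mulr0.
Qed.

Lemma form_minus_ndeg v : (forall u, h u v = 0) -> v = 0.
Proof. by move=> v0; apply: chains_separate => i; apply: v0. Qed.

Local Notation T := (sigma_mp f).
Let sP := sigma_mpP form_minus_ndeg.

(** Both sides have the same pairings with all basis vectors, by the definition
    of [sigma^{-+}]. *)
Lemma chainE_step j : T (2%:R *: chainE j - chainE j.+1) = -1 *: chainE j.+1.
Proof.
apply/eqP; rewrite -subr_eq0; apply/eqP/chains_separate => i.
  rewrite [LHS]linearBr /= -sP scaleN1r linearNr /= opprK linearBr linearZr_LR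
    /=.
  by rewrite /form_plus /form_minus !gram_EE; ring.
rewrite [LHS]linearBr /= -sP scaleN1r linearNr /= opprK linearBr linearZr_LR /=.
by rewrite form_minusC ![form_plus _ (chainG i) _]form_plusC !plus_EG minus_EG
  addnS addSn addnS; ring.
Qed.

Lemma chainG_step j : T (2%:R *: chainG j - chainG j.+1) = 1 *: chainG j.+1.
Proof.
apply/eqP; rewrite -subr_eq0; apply/eqP/chains_separate => i.
  rewrite [LHS]linearBr /= -sP scale1r linearBr linearZr_LR /=.
  by rewrite !plus_EG minus_EG; ring.
rewrite [LHS]linearBr /= -sP scale1r linearBr linearZr_LR /=.
by rewrite /form_plus /form_minus !gram_GG; ring.
Qed.

Local Notation spanE := (chain_span n chainE).
Local Notation spanG := (chain_span n chainG).

Lemma spanE_iter k v : v \in spanE -> iter k T v \in spanE.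
Proof. exact: (chain_span_iter two_neq0 chainE_step chainE_out). Qed.

Lemma spanG_iter k v : v \in spanG -> iter k T v \in spanG.
Proof. exact: (chain_span_iter two_neq0 chainG_step chainG_out). Qed.

Lemma spanE_isotropic : {in spanE &, forall v w, h v w = 0}.
Proof.
by apply: chain_span_isotropic => i j _ _;
  rewrite /= /form_minus !gram_EE subrr.
Qed.

Lemma spanG_isotropic : {in spanG &, forall v w, h v w = 0}.
Proof.
by apply: chain_span_isotropic => i j _ _;
  rewrite /= /form_minus !gram_GG subrr.
Qed.

Lemma sigma_iter_skew k x y : h (iter k T x) y = (-1) ^+ k * h x (iter k T y).
Proof.
elim: k x y => [|k IH] x y; first by rewrite mul1r.
by rewrite iterSr IH /= sigma_mp_skew ?exprS ?mulrN ?mulN1r ?mulNr //;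
  exact: form_minus_ndeg.
Qed.

Let u := chainE 0.

Lemma chainE_nil k : (n <= k)%N -> iter k T u = 0.
Proof.
move=> /subnK <-; rewrite iterD (chain_nil two_neq0 chainE_step chainE_out).
by elim: (k - n)%N => //= m ->; rewrite linear0.
Qed.

Lemma chainE_top : h (iter n.-1 T u) (chainG 0) != 0.
Proof.
have eq2 := chain_last two_neq0 chainE_step chainE_out n_gt0.
have : h (2%:R ^+ n.-1 *: iter n.-1 T u) (chainG 0) != 0.
  rewrite eq2 linearZl_LR /= minus_EG addn0 eqxx.
  rewrite (_ : (n.-1 + 1 == n.-1)%N = false) ?subr0; last by apply/eqP; lia.
  by rewrite mulr1 mulf_neq0 // expf_neq0 // oppr_eq0 oner_neq0.
by rewrite linearZl_LR /=; apply: contraNneq => ->; rewrite mulr0.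
Qed.

(** A multiple of the first vector of the second chain pairs correctly with
    [T^{n-1} u]; subtracting multiples of [T^k w] for increasing [k] then
    corrects the pairings with [T^{n-1-k} u] without disturbing the ones already
    settled. *)
Lemma dual_vector :
  exists2 w, w \in spanG & forall i, h (iter i T u) w = (i == n.-1)%:R.
Proof.
suff [w wG wP] : exists2 w, w \in spanG &
    forall i, (n.-1 <= i + n.-1)%N -> h (iter i T u) w = (i == n.-1)%:R.
  by exists w => // i; apply: wP; rewrite leq_addl.
elim: {2}n.-1 => [|k [w wG wP]].
  exists ((h (iter n.-1 T u) (chainG 0))^-1 *: chainG 0).
    exact/rpredZ/mem_chain_span/chainG_out.
  move=> i; rewrite addn0 linearZr_LR /= => le_i.
  case: eqP => [->|ne]; first by rewrite mulVf ?chainE_top.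
  by rewrite (@chainE_nil i) ?linear0l ?mulr0 //; lia.
(* [c] is the pairing in the next degree, which the correction has to cancel. *)
pose c := h (iter (n.-1 - k.+1) T u) w.
have [lt_kn|le_nk] := ltnP k n.-1; last first.
  by exists w => // i _; apply: wP; lia.
exists (w - ((-1) ^+ k.+1 * c) *: iter k.+1 T w).
  by rewrite rpredB // rpredZ // spanG_iter.
move=> i le_i; rewrite linearBr linearZr_LR /=.
rewrite mulrAC -[T _]/(iter k.+1 T w) -sigma_iter_skew -iterD (wP (k.+1 +
  i)%N); last by lia.
have [i_eq|i_ne] := eqVneq (k.+1 + i)%N n.-1.
  rewrite mul1r /c (_ : (n.-1 - k.+1)%N = i); last by lia.
  by rewrite subrr (_ : (i == n.-1) = false) //; apply/eqP; lia.
by rewrite mul0r subr0 wP //; lia.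
Qed.

(** Parity enters here: [f^-(u, T^{n-1} w)] and [f^-(w, T^{n-1} u)] differ by the
    sign required by [symplectic2] because [n - 1] is even. *)
Lemma hyperbolic_pair : odd n -> exists b : 'I_2 -> V, forall i j k,
  h (b i) (iter k T (b j)) = symplectic2 F i j * (k == n.-1)%:R.
Proof.
move=> n_odd; have [w wG wP] := dual_vector.
have uE : u \in spanE by apply/mem_chain_span/chainE_out.
exists (fun i => if i == 0 then u else w).
apply: ord2_ind; apply: ord2_ind => k; rewrite !mxE /=.
- by rewrite spanE_isotropic ?spanE_iter // mul0r.
- rewrite -[h _ _]mul1r -(signrMK k 1) mulr1 -mulrA -sigma_iter_skew wP.
  case: eqP => [->|]; last by rewrite !mulr0.
  by rewrite -signr_odd (_ : odd n.-1 = false) ?mul1r //; lia.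
- by rewrite form_minusC wP expr1 mulN1r.
- by rewrite spanG_isotropic ?spanG_iter // mul0r.
Qed.

End GramChains.

(** * Quotients, simplicity and annihilators *)

Section QuotientIso.
Variables (F : fieldType) (g h : finLieAlgType F) (phi : {linear g -> h}).
Variable Z : lieIdeal g.
Hypothesis phi_lie : forall x y, phi (lie x y) = lie (phi x) (phi y).
Hypothesis phi_surj : forall z, exists y, phi y = z.
Hypothesis phi_ker : lker (linfun phi) = Z.

(** The inverse isomorphism: any preimage under [phi] will do, since preimages
    differ by elements of the kernel [Z]. *)
Definition quot_section (z : h) : quot_lie Z :=
  quot_proj Z ((linfun phi)^-1%VF z).

Fact quot_section_is_linear : linear quot_section.
Proof.
by move=> a x y; rewrite /quot_section linearP quot_projD quot_projZ.
Qed.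
HB.instance Definition _ :=
  GRing.isLinear.Build F h (quot_lie Z) _ quot_section quot_section_is_linear.

Lemma quot_sectionK x : quot_section (phi x) = quot_proj Z x.
Proof.
apply/quot_projP; rewrite -phi_ker memv_ker lfunE linearB /= subr_eq0.
by rewrite -[phi (_^-1%VF _)](lfunE phi) -[phi x](lfunE phi) limg_lfunVK
  ?memv_img ?memvf.
Qed.

Lemma surj_lie_isomorphic : lie_isomorphic h (quot_lie Z).
Proof.
exists quot_section; split=> [|z z'].
  exists (fun q => phi (repr q)) => [z|q].
    have [y <-] := phi_surj z; apply/eqP.
    rewrite /= quot_sectionK -subr_eq0 -linearB -[phi _](lfunE phi) -memv_ker
      phi_ker.
    exact: repr_quot_proj.
  by rewrite /= quot_sectionK quot_proj_repr.
have [y <-] := phi_surj z; have [y' <-] := phi_surj z'.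
by rewrite -phi_lie /= !quot_sectionK quot_proj_lie.
Qed.

End QuotientIso.

Section Sl2Reductive.
Variables (F : fieldType) (g : finLieAlgType F) (x y h : g).
Hypothesis two_neq0 : 2%:R != 0 :> F.
Hypothesis hx : lie h x = 2%:R *: x.
Hypothesis hy : lie h y = (- 2%:R) *: y.
Hypothesis xy : lie x y = h.
Hypothesis spanned : forall z : g, exists a b c, z = a *: x + b *: y + c *: h.

(** Bracketing twice with [x] kills all coefficients of an element but that of
    [y], and symmetrically; so a non-zero ideal contains [h], which generates
    everything as 2 is invertible. *)
Lemma sl2_simple (I : {vspace g}) : lie_ideal I -> I = 0%VS \/ I = fullv.
Proof.
move=> idI.
have idI' u v : u \in I -> lie u v \in I.
  by move=> uI; rewrite lie_skew rpredN idI.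
have yx : lie y x = - h by rewrite lie_skew xy.
have xh : lie x h = (- 2%:R) *: x by rewrite lie_skew hx scaleNr.
have yh : lie y h = 2%:R *: y by rewrite lie_skew hy scaleNr opprK.
have scal a u : a != 0 -> a *: u \in I -> u \in I.
  by move=> a0 auI; rewrite -[u]scale1r -(mulVf a0) -scalerA rpredZ.
have two2 : - 2%:R != 0 :> F by rewrite oppr_eq0.
have full : h \in I -> I = fullv.
  move=> hI; apply/eqP; rewrite eqEsubv subvf; apply/subvP => z _.
  have xI : x \in I by apply: (scal _ _ two_neq0); rewrite -hx idI'.
  have yI : y \in I by apply: (scal _ _ two2); rewrite -hy idI'.
  by have [a [b [c ->]]] := spanned z; rewrite !rpredD ?rpredZ.
have [->|I0] := eqVneq I 0%VS; [by left | right].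
have := memv_pick I; move: I0; rewrite -vpick0; set z := vpick I.
have [a [b [c ->]]] := spanned z => z0 zI.
have lx : lie x (a *: x + b *: y + c *: h) = b *: h - (2%:R * c) *: x.
  by rewrite !linearD !linearZ /= liexx xy xh scaler0 add0r scalerA mulrN
    scaleNr (mulrC c) ?scalerN.
have ly : lie y (a *: x + b *: y + c *: h) = - (a *: h) + (2%:R * c) *: y.
  by rewrite !linearD !linearZ /= liexx yx yh scaler0 addr0 scalerN scalerA
    (mulrC c).
have [b0|bn0] := eqVneq b 0; last first.
  apply: full; rewrite -xy; apply/idI'; apply: (scal (b * - 2%:R)).
    by rewrite mulf_neq0.
  have := idI x _ (idI x _ zI);
    rewrite lx linearB !linearZ /= liexx xh ?oppr0 scaler0 ?oppr0 addr0.
  by rewrite scalerA.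
have [a0|an0] := eqVneq a 0; last first.
  apply: full; rewrite -xy; apply/idI; apply: (scal (- (a * 2%:R))).
    by rewrite oppr_eq0 mulf_neq0.
  have := idI y _ (idI y _ zI);
    rewrite ly linearD linearN !linearZ /= liexx yh scaler0 addr0.
  by rewrite ?scalerN scaleNr ?scalerA.
move: z0 zI; rewrite a0 b0 !scale0r !add0r => c0 cI; apply: full;
  apply: scal cI.
by apply: contraNneq c0 => ->; rewrite scale0r.
Qed.

(** The derived algebra is an ideal, so it is everything or zero; in the first
    case the whole algebra is not solvable unless it is zero, and in the second
    the relations force the algebra to be zero. *)
Lemma sl2_reductive : lie_reductive g.
Proof.
move=> I idI [k]; have [->|->] := sl2_simple idI; first by rewrite sub0v.
have perfect : lie_span fullv fullv = fullv :> {vspace g}.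
  have spanI : lie_ideal (lie_span fullv fullv : {vspace g}).
    by move=> u v _; apply: mem_lie_span; rewrite memvf.
  have [span0|//] :=
    sl2_simple spanI; apply/eqP; rewrite span0 eqEsubv sub0v;
      apply/subvP => z _.
  have zero u v : lie u v = 0 :> g.
    by apply/eqP; rewrite -memv0 -span0 mem_lie_span ?memvf.
  have x0 : x = 0.
    by apply/eqP; have /eqP := hx;
      rewrite zero eq_sym scaler_eq0 (negPf two_neq0).
  have y0 : y = 0.
    by apply/eqP; have /eqP := hy;
      rewrite zero eq_sym scaler_eq0 oppr_eq0 (negPf two_neq0).
  have [a [b [c ->]]] := spanned z.
  by rewrite x0 y0 -xy zero !scaler0 !addr0 mem0v.
have -> : derived_series (fullv : {vspace g}) k = fullv.
  by elim: k => //= k ->.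
by move=> ->; rewrite sub0v.
Qed.

End Sl2Reductive.

Section Annihilator.
Variables (F : fieldType) (V : vectType F) (f : {biscalar V}).

(** The product of two such endomorphisms is already zero. *)
Lemma annihil_abelian (W : {vspace V}) : lie_abelian (form_lie_annihil f W).
Proof.
move=> x y /form_lie_annihilP[xW x0] /form_lie_annihilP[yW y0].
apply: subvs_inj; rewrite form_lie_bracket linear0; apply/lfunP => v.
by rewrite lie_glE zero_lfunE x0 // y0 // subrr.
Qed.

Lemma annihil_ideal (W : {vspace V}) :
    (forall (x : form_lie f) w, w \in W -> vsval x w \in W) ->
  lie_ideal (form_lie_annihil f W).
Proof.
move=> stabW x y /form_lie_annihilP[yW y0]; apply/form_lie_annihilP.
split=> [v|w wW]; rewrite form_lie_bracket lie_glE.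
  by apply: rpredB; [apply/stabW/yW | apply: yW].
by rewrite y0 // linear0 sub0r y0 ?oppr0 ?stabW.
Qed.

End Annihilator.

Lemma abelian_solvable (F : fieldType) (g : finLieAlgType F) (I : {vspace g}) :
  lie_abelian I -> lie_solvable I.
Proof.
move=> abI; exists 1%N; apply/eqP; rewrite -subv0;
  apply: lie_span_min => x y xI yI.
by rewrite memv0 abI.
Qed.

(** * The truncated current algebra of gl_2 *)

Lemma tens_pure_neq0 (F : fieldType) (U W : vectType F) (u : U) (w : W) :
  u != 0 -> w != 0 -> tens_pure u w != 0.
Proof.
move=> u0 w0; apply: contraNneq w0 => /matrixP uw0; apply/eqP.
rewrite (coord_vbasis (memvf w)) big1 // => j _.
apply/eqP; rewrite scaler_eq0; apply/orP; left; apply: contraR u0 => wj.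
rewrite (coord_vbasis (memvf u)) big1 // => i _.
have /eqP := uw0 i j; rewrite !mxE mulf_eq0 (negPf wj) orbF => /eqP ->.
by rewrite scale0r.
Qed.

Section TruncatedCurrent.
Variables (F : fieldType) (m : nat).
Hypothesis m_gt0 : (0 < m)%N.
Local Notation A := {poly %/ ('X^m : {poly F})}.
Local Notation cur := (current 'M[F]_2 m).

Lemma mk_monic_Xn_gt0 : mk_monic ('X^m : {poly F}) = 'X^m.
Proof. by rewrite mk_monic_Xn prednK. Qed.

Lemma coef_in_qpoly_Xn p k : (k < m)%N -> (in_qpoly 'X^m p : {poly F})`_k =
  p`_k.
Proof.
move=> km; rewrite [in RHS](Pdiv.RingMonic.rdivp_eq (monicXn F m) p).
by rewrite coefD coefMXn km add0r /= mk_monic_Xn_gt0.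
Qed.

Lemma coef_qpoly_Xn_ge (p : A) k : (m <= k)%N -> p`_k = 0.
Proof.
move=> mk; rewrite nth_default // (leq_trans _ mk) //.
by rewrite -ltnS (leq_trans (size_mk_monic p)) // mk_monic_Xn_gt0 size_polyXn.
Qed.

Lemma qpoly_Xn_ext (p q : A) : (forall i, (i < m)%N -> p`_i = q`_i) -> p = q.
Proof.
move=> pq; apply/val_inj/polyP => i.
by have [/pq//|mi] := ltnP i m; rewrite !coef_qpoly_Xn_ge.
Qed.

Lemma dim_current_gl2 : \dim {:cur} = (4 * m)%N.
Proof.
rewrite dimvf /dim /= dim_polyn mk_monic_Xn_gt0 size_polyXn.
by rewrite dimvf /dim.
Qed.

(** Every element has this form, so the morphism below can be computed entry by
    entry. *)
Definition entry_tens (p : 'I_2 -> 'I_2 -> A) : cur :=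
  \sum_i \sum_j tens_pure (delta_mx i j) (p i j).

Lemma entry_tens_surj (y : cur) : exists p, y = entry_tens p.
Proof.
elim/tens_ind: y => [|_ _ [p ->] [q ->]|a p].
- exists (fun _ _ => 0); rewrite /entry_tens big1 // => i _;
  rewrite big1 // => j _.
  by rewrite linear0r.
- exists (fun i j => p i j + q i j); rewrite /entry_tens -big_split.
  apply: eq_bigr => i _; rewrite -big_split; apply: eq_bigr => j _.
  by rewrite linearDr.
exists (fun i j => a i j *: p); rewrite {1}(matrix_sum_delta a) linear_sumlz.
apply: eq_bigr => i _; rewrite /= linear_sumlz; apply: eq_bigr => j _ /=.
by rewrite linearZl_LR linearZr_LR.
Qed.

Lemma entry_tens_scalar (p : A) : tens_pure 1%:M p =
  entry_tens (fun i j => if i == j then p else 0).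
Proof.
rewrite /entry_tens !sum_ord2 /= !linear0r addr0 add0r -linearDl /=.
by congr (tens_pure _ _); apply/matrixP; apply: ord2_ind; apply: ord2_ind;
  rewrite !mxE /= ?addr0 ?add0r.
Qed.

(** The scalar matrix [X^(m-1)], which spans the ideal to be factored out. *)
Definition top_tensor : cur := tens_pure 1%:M (in_qpoly 'X^m 'X^(m.-1) : A).

Lemma dim_top_tensor : \dim <[top_tensor]> = 1%N.
Proof.
rewrite dim_vline tens_pure_neq0 //; first exact: matrix_nonzero1.
apply/eqP => /(congr1 (fun q : A => q`_m.-1));
  rewrite coef_in_qpoly_Xn ?prednK //.
by rewrite coefXn eqxx coef0 => /eqP; rewrite oner_eq0.
Qed.

Lemma top_tensor_central : (<[top_tensor]> <= lie_center cur)%VS.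
Proof.
rewrite -memvE; apply/lie_centerP; elim/tens_ind => [|x y hx hy|a p].
- by rewrite linear0.
- by rewrite linearD /= hx hy addr0.
rewrite lie_current (_ : lie 1%:M a = 0) ?linear0l //.
by rewrite /lie /= /gl_mx_bracket mul1mx mulmx1 subrr.
Qed.

End TruncatedCurrent.

(** * Matrices over F[X] attached to the current algebra *)

Lemma coef_comp_sqr (R : nzRingType) (q : {poly R}) k :
  (q \Po 'X^2)`_k = if odd k then 0 else q`_k./2.
Proof. by rewrite coef_comp_poly_Xn // dvdn2 divn2; case: odd. Qed.

Lemma coef_comp_sqrX (R : nzRingType) (q : {poly R}) k :
  ((q \Po 'X^2) * 'X)`_k = if odd k then q`_k./2 else 0.
Proof.
rewrite coefMX; case: k => //= k; rewrite coef_comp_sqr uphalf_half.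
by case: odd.
Qed.

Lemma symplectic2E (F : fieldType) :
  (symplectic2 F 0 0 = 0) * (symplectic2 F 0 1 = 1) *
  (symplectic2 F 1 0 = -1) * (symplectic2 F 1 1 = 0).
Proof. by rewrite /symplectic2 !mxE /= expr0 expr1. Qed.

Section CurrentMatrix.
Variable F : fieldType.
Hypothesis two_neq0 : 2%:R != 0 :> F.
Implicit Types (a : 'M[F]_2) (p : {poly F}).

Definition half_trace a : F := 2%:R^-1 * \tr a.

(** The traceless part of [a] is multiplied by [p(X^2)] and the scalar part by
    [X p(X^2)].  The extra factor [X] makes the scalar matrices skew, and it
    causes the one dimensional kernel. *)
Definition current_mx a p : 'M[{poly F}]_2 :=
  (p \Po 'X^2) *: map_mx polyC (a - (half_trace a)%:M)
  + ((half_trace a)%:P * ((p \Po 'X^2) * 'X))%:M.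

Lemma half_traceP c a a' :
  half_trace (c *: a + a') = c * half_trace a + half_trace a'.
Proof. by rewrite /half_trace linearP /= mulrDr mulrCA. Qed.

Lemma current_mxPl c a a' p : current_mx (c *: a + a') p =
  c%:P *: current_mx a p + current_mx a' p.
Proof.
rewrite /current_mx half_traceP; apply/matrixP => i j; rewrite !mxE.
rewrite !(polyCD, polyCM, polyCB, polyCN, polyCMn); case: (i == j);
  rewrite ?mulr1n ?mulr0n; ring.
Qed.

Lemma current_mxPr c a p p' : current_mx a (c *: p + p') =
  c%:P *: current_mx a p + current_mx a p'.
Proof.
rewrite /current_mx comp_polyD comp_polyZ -mul_polyC; apply/matrixP => i j.
by rewrite !mxE; case: (i == j); rewrite ?mulr1n ?mulr0n; ring.
Qed.

(** The scalar parts commute with everything, and a bracket is traceless. *)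
Lemma current_mx_lie a a' p p' :
  current_mx (lie a a') (p * p') = current_mx a p *m current_mx a' p' -
    current_mx a' p' *m current_mx a p.
Proof.
have tr0 : half_trace (lie a a') = 0.
  by rewrite /half_trace linearB /= mxtrace_mulC subrr mulr0.
rewrite /current_mx tr0 comp_polyM mul0r; set t := half_trace a;
  set t' := half_trace a'.
have -> : lie a a' - 0%:M =
  (a - t%:M) *m (a' - t'%:M) - (a' - t'%:M) *m (a - t%:M).
  rewrite !(mulmxBl, mulmxBr) !(mul_scalar_mx, mul_mx_scalar) !scale_scalar_mx.
  rewrite [_ * t]mulrC; apply/matrixP => i j; rewrite !mxE.
  by case: (i == j); rewrite ?mulr1n ?mulr0n; ring.
rewrite raddf0 addr0 map_mxB !map_mxM.
set M := map_mx _ _; set M' := map_mx _ _; set q := _ \Po _; set q' := _ \Po _.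
rewrite !(mulmxDl, mulmxDr) !(mul_scalar_mx, mul_mx_scalar) -!scalemxAl
  -!scalemxAr.
rewrite scalerBr !scalerA; set P := M *m M'; set P' := M' *m M.
apply/matrixP => i j; rewrite !mxE; case: (i == j); rewrite ?mulr1n ?mulr0n;
  ring.
Qed.

(** Even coefficients come from the traceless part, odd ones from the trace. *)
Lemma coef_current_mx a p k : [/\
  (current_mx a p 0 1)`_k = if odd k then 0 else a 0 1 * p`_k./2,
  (current_mx a p 1 0)`_k = if odd k then 0 else a 1 0 * p`_k./2,
  (current_mx a p 0 0)`_k = 2%:R^-1 * (a 0 0 - (-1) ^+ odd k * a 1 1) * p`_k./2
  & (current_mx a p 1 1)`_k = 2%:R^-1 * (a 1 1 - (-1) ^+ odd k * a 0 0) *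
    p`_k./2].
Proof.
have tr2 : half_trace a = 2%:R^-1 * (a 0 0 + a 1 1).
  by rewrite /half_trace /mxtrace sum_ord2.
split; rewrite /current_mx !mxE /= ?mulr0n ?mulr1n ?subr0 ?addr0 ?coefD coefMC;
  rewrite ?coefCM coef_comp_sqr ?coef_comp_sqrX ?tr2;
  case: odd; rewrite ?mul0r ?expr1 ?expr0 //; try ring; by field;
    rewrite ?two_neq0.
Qed.

Lemma coef_entry_current_mx m (p : 'I_2 -> 'I_2 ->
  {poly %/ ('X^m : {poly F})}) k :
  let M := \sum_i \sum_j current_mx (delta_mx i j) (p i j) in
  [/\ (M 0 1)`_k = if odd k then 0 else (p 0 1)`_k./2,
  (M 1 0)`_k = if odd k then 0 else (p 1 0)`_k./2,
  (M 0 0)`_k = 2%:R^-1 * ((p 0 0)`_k./2 - (-1) ^+ odd k * (p 1 1)`_k./2)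
  & (M 1 1)`_k = 2%:R^-1 * ((p 1 1)`_k./2 - (-1) ^+ odd k * (p 0 0)`_k./2)].
Proof.
move=> M; rewrite /M !sum_ord2.
have [a01 a10 a00 a11] := coef_current_mx (delta_mx 0 0) (p 0 0) k.
have [b01 b10 b00 b11] := coef_current_mx (delta_mx 0 1) (p 0 1) k.
have [c01 c10 c00 c11] := coef_current_mx (delta_mx 1 0) (p 1 0) k.
have [d01 d10 d00 d11] := coef_current_mx (delta_mx 1 1) (p 1 1) k.
have M_k i j : (current_mx (delta_mx 0 0) (p 0 0) + current_mx (delta_mx 0 1)
  (p 0 1) +
    (current_mx (delta_mx 1 0) (p 1 0) + current_mx (delta_mx 1 1) (p 1 1))) i
      j =
    current_mx (delta_mx 0 0) (p 0 0) i j + current_mx (delta_mx 0 1) (p 0 1) i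
      j +
    (current_mx (delta_mx 1 0) (p 1 0) i j + current_mx (delta_mx 1 1) (p 1 1)
      i j).
  by rewrite [LHS]mxE; congr (_ + _); rewrite [LHS]mxE.
rewrite !M_k !coefD; split;
  rewrite ?(a01, a10, a00, a11) ?(b01, b10, b00, b11) ?(c01, c10, c00, c11)
    ?(d01, d10, d00, d11) !mxE /=; case: odd; ring.
Qed.

End CurrentMatrix.

(** * The morphism from the current algebra onto L(f) *)

Section CurrentHom.
Variables (F : fieldType) (V : vectType F) (f : {biscalar V}).
Variables (n : nat) (b : 'I_2 -> V).
Hypothesis two_neq0 : 2%:R != 0 :> F.
Hypothesis ndeg : forall v, (forall u, form_minus f u v = 0) -> v = 0.
Local Notation h := (form_minus f).
Local Notation T := (sigma_mp f).
Hypothesis b_gram : forall i j k,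
  h (b i) (iter k T (b j)) = symplectic2 F i j * (k == n.-1)%:R.
Hypothesis n_gt0 : (0 < n)%N.
Hypothesis n_odd : odd n.
Hypothesis dimV : \dim {:V} = (2 * n)%N.
Local Notation m := (n + 1)./2.
Local Notation op := (opmx h T n b).
Local Notation A := {poly %/ ('X^m : {poly F})}.
Local Notation cur := (current 'M[F]_2 m).

Let m_gt0 : (0 < m)%N. Proof. by lia. Qed.
Let T_skew x y : h (T x) y = - h x (T y) := sigma_mp_skew ndeg x y.

Lemma opmx_current_mx_mem a p : op (current_mx a p) \in form_lie_space f.
Proof.
apply/form_lie_sigmaP => //; split; first exact: opmx_comm.
apply/opmx_skewP => //; apply: ord2_ind; apply: ord2_ind => k _;
  rewrite !sum_ord2 !symplectic2E -signr_odd;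
  have [c01 c10 c00 c11] := coef_current_mx two_neq0 a p k;
  rewrite ?c00 ?c01 ?c10 ?c11; case: odd; ring.
Qed.

(** The truncation at [X^m] becomes [X^(2m) = X^(n+1)] after substituting [X^2],
    and [X^n] already acts as zero. *)
Lemma opmx_current_mx_mod a p : op (current_mx a (in_qpoly 'X^m p : A)) =
  op (current_mx a p).
Proof.
apply/eqP/opmx_eq => // i j; apply/polyP => k; rewrite !coef_take_poly.
case: ltnP => // kn.
have pk : (in_qpoly 'X^m p : {poly F})`_k./2 = p`_k./2.
  by rewrite coef_in_qpoly_Xn //; lia.
move: i j; apply: ord2_ind; apply: ord2_ind;
  have [c01 c10 c00 c11] := coef_current_mx two_neq0 a p k;
  have [d01 d10 d00 d11] := coef_current_mx two_neq0 a (in_qpoly 'X^m p : A) k;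
  by rewrite ?(c00, c01, c10, c11, d00, d01, d10, d11) pk.
Qed.

Definition current_to_form_pure (a : 'M[F]_2) (p : A) : form_lie f :=
  vsproj (form_lie_space f) (op (current_mx a p)).

Lemma current_to_form_pureE a p : vsval (current_to_form_pure a p) =
  op (current_mx a p).
Proof. by rewrite vsprojK // opmx_current_mx_mem. Qed.

Fact current_to_form_pure_bilinear : bilinear_for *:%R *:%R
  current_to_form_pure.
Proof.
by split=> z c x y; apply: subvs_inj; rewrite linearP /= !current_to_form_pureE
  -(opmxZ b_gram n_gt0 dimV) -(opmxD b_gram n_gt0 dimV) ?current_mxPl
    -?current_mxPr.
Qed.
HB.instance Definition _ := bilinear_isBilinear.Build F 'M[F]_2 A (form_lie f)
  *:%R *:%R current_to_form_pure current_to_form_pure_bilinear.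

Definition current_to_form : cur -> form_lie f :=
  tens_lift current_to_form_pure.
HB.instance Definition _ := GRing.Linear.on current_to_form.

Lemma current_to_formE a p : current_to_form (tens_pure a p) =
  current_to_form_pure a p.
Proof. exact: tens_liftE. Qed.

(** [current_mx] is already a morphism of Lie algebras before truncation. *)
Lemma current_to_form_morph x y :
  current_to_form (lie x y) = lie (current_to_form x) (current_to_form y).
Proof.
elim/tens_ind: x => [|x x' hx hx'|a p].
- by rewrite linear0l !linear0 linear0l.
- by rewrite linearDl !linearD /= hx hx' linearDl.
elim/tens_ind: y => [|y y' hy hy'|a' p'].
- by rewrite !linear0.
- by rewrite !linearD /= hy hy'.
rewrite lie_current !current_to_formE; apply: subvs_inj.
rewrite form_lie_bracket !current_to_form_pureE poly_of_qpolyM.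
rewrite [current_mx _ _](_ : _ = current_mx (lie a a') (in_qpoly 'X^m ((p :
  {poly F}) * p') : A)) //.
rewrite opmx_current_mx_mod current_mx_lie.
rewrite (opmxB b_gram n_gt0 dimV) !(opmxM b_gram n_gt0 dimV).
by [].
Qed.

Lemma current_to_form_entry p : vsval (current_to_form (entry_tens p)) =
  op (\sum_i \sum_j current_mx (delta_mx i j) (p i j)).
Proof.
have opD := opmxD b_gram n_gt0 dimV; rewrite /entry_tens !sum_ord2 opD.
rewrite (opD (current_mx (delta_mx 0 0) _)) (opD (current_mx (delta_mx 1 0) _))
  !linearD /=.
by rewrite !current_to_formE !current_to_form_pureE.
Qed.

(** The even part of the upper left entry is the [sl_2]-component and its odd
    part is the central one; the skewness relations determine the lower right
    entry and make the other two entries even. *)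
Lemma current_to_form_surj z : exists y, current_to_form y = z.
Proof.
have /form_lie_sigmaP[//|//|zT zh] := subvsP z.
have opz := opmx_surj b_gram n_gt0 dimV zT.
set B := \matrix_(i, j) _ in opz; rewrite opz in zh.
have /opmx_skewP-/(_ T_skew b_gram n_gt0 dimV) := zh.
move=> Bk.
pose ev (i j : 'I_2) := in_qpoly 'X^m (even_poly (B i j)) : A.
pose od := in_qpoly 'X^m (odd_poly (B 0 0)) : A.
pose p (i j : 'I_2) : A :=
  if i == j then od + (-1) ^+ (i : nat) *: ev 0 0 else ev i j.
(* The diagonal entries are the odd part plus or minus the even part. *)
exists (entry_tens p); apply: subvs_inj; rewrite current_to_form_entry opz.
apply/eqP/opmx_eq => // i j; apply/polyP => k; rewrite !coef_take_poly.
case: ltnP => // kn.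
have km : (k./2 < m)%N by lia.
have evE i' j' : (ev i' j' : {poly F})`_k./2 = (B i' j')`_k./2.*2.
  by rewrite coef_in_qpoly_Xn // coef_even_poly.
have odE : (od : {poly F})`_k./2 = (B 0 0)`_k./2.*2.+1.
  by rewrite coef_in_qpoly_Xn // coef_odd_poly.
have p00 : (p 0 0 : {poly F})`_k./2 = (B 0 0)`_k./2.*2.+1 + (B 0 0)`_k./2.*2.
  by rewrite /p /= coefD coefZ expr0 mul1r evE odE.
have p11 : (p 1 1 : {poly F})`_k./2 = (B 0 0)`_k./2.*2.+1 - (B 0 0)`_k./2.*2.
  by rewrite /p /= coefD coefZ expr1 mulN1r evE odE.
have [c01 c10 c00 c11] := coef_entry_current_mx two_neq0 p k.
have B11 : (-1) ^+ odd k * (B 0 0)`_k = - (B 1 1)`_k.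
  have := Bk 0 1 k kn; rewrite !sum_ord2 !symplectic2E signr_odd.
  by rewrite !(mul0r, mul1r, add0r, addr0).
have B01 : (-1) ^+ odd k * (B 0 1)`_k = (B 0 1)`_k.
  have := Bk 1 1 k kn; rewrite !sum_ord2 !symplectic2E signr_odd.
  by rewrite !(mul0r, mul1r, addr0, mulN1r) opprK.
have B10 : (-1) ^+ odd k * (B 1 0)`_k = (B 1 0)`_k.
  have := Bk 0 0 k kn; rewrite !sum_ord2 !symplectic2E signr_odd.
  by rewrite !(mul0r, mul1r, add0r, mulN1r) => /oppr_inj.
have half x : 2%:R^-1 * (x + x) = x :> F by field; rewrite two_neq0.
have skew0 (x : F) : (-1) ^+ true * x = x -> 0 = x.
  rewrite expr1 mulN1r => xx; apply/esym/eqP.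
  by have /eqP := half x; rewrite -{2}xx subrr mulr0 eq_sym.
move: i j c01 c10 c00 c11 B11 B01 B10 (odd_double_half k); rewrite p00 p11 !evE.
case: (odd k); rewrite ?add1n ?add0n => i j + + + + + + + kE; rewrite kE;
  move: i j; apply: ord2_ind; apply: ord2_ind => c01 c10 c00 c11 B11 B01 B10;
  rewrite ?(c00, c01, c10, c11) //; try exact: skew0.
- by rewrite -[RHS]half; ring.
- by rewrite -[RHS]opprK -B11 -[in RHS](half (B 0 0)`_k); ring.
- by rewrite -[RHS]half; ring.
- by rewrite -[RHS]opprK -B11 -[in RHS](half (B 0 0)`_k); ring.
Qed.

Lemma opmx0 : op 0 = 0.
Proof. by rewrite -[X in op X](subrr 0) (opmxB b_gram n_gt0 dimV) subrr. Qed.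

Lemma current_to_form_entry_eq0 (p : 'I_2 -> 'I_2 -> A) :
  current_to_form (entry_tens p) = 0 <->
  forall i j k, (k < n)%N ->
    ((\sum_i \sum_j current_mx (delta_mx i j) (p i j)) i j)`_k = 0.
Proof.
split=> [p0 i j k kn|p0].
  have : op (\sum_i \sum_j current_mx (delta_mx i j) (p i j)) == op 0.
    by rewrite -current_to_form_entry p0 linear0 opmx0.
  move=> /opmx_eq-/(_ b_gram n_gt0 dimV i j)/polyP/(_ k).
  by rewrite !coef_take_poly kn mxE coef0.
apply: subvs_inj; rewrite current_to_form_entry linear0 -opmx0.
apply/eqP/opmx_eq => // i j; apply/polyP => k; rewrite !coef_take_poly.
by case: ltnP => // kn; rewrite mxE coef0 p0.
Qed.

(** Every coefficient up to [X^(n-1)] is seen by [V].  For the traceless part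
    this covers all degrees below [m], since [2(m-1) = n-1]; the factor [X] on
    scalars pushes the top degree [m-1] to [X^n], where it is lost. *)
Lemma current_to_form_ker : lker (linfun current_to_form) =
  <[top_tensor F m]>%VS.
Proof.
apply/eqP; rewrite eqEsubv; apply/andP; split; last first.
  rewrite -memvE memv_ker lfunE /= /top_tensor entry_tens_scalar.
  pose p (i j : 'I_2) : A := if i == j then in_qpoly 'X^m 'X^(m.-1) else 0.
  rewrite -[X in entry_tens X]/p.
  apply/eqP/current_to_form_entry_eq0 => i j k kn; move: i j.
  have [c01 c10 c00 c11] := coef_entry_current_mx two_neq0 p k.
  have x0 : (if odd k then (p 0 0)`_k./2 else 0) = 0.
    case k_odd: (odd k) => //; rewrite /p /= (coef_in_qpoly_Xn m_gt0) ?coefXn;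
      last by lia.
    by case: eqP => //; lia.
  have p01 : p 0 1 = 0 by [].
  have p10 : p 1 0 = 0 by [].
  have p11 : p 1 1 = p 0 0 by [].
  by apply: ord2_ind; apply: ord2_ind;
    rewrite ?(c00, c01, c10, c11) ?(p01, p10) ?p11;
    case: (odd k) x0 => x0; rewrite ?x0 //;
    rewrite ?coef0 // ?expr1 ?expr0 ?mul1r ?mulr0 ?subrr ?mulr0.
apply/subvP => v; have [p ->] := entry_tens_surj v.
rewrite memv_ker lfunE => /eqP/current_to_form_entry_eq0 p0.
have half_eq0 (x : F) : 2%:R^-1 * x = 0 -> x = 0.
  by move/eqP; rewrite mulf_eq0 invr_eq0 (negPf two_neq0) => /eqP.
have even_k i : (i < m)%N -> [/\ (p 0 1)`_i = 0, (p 1 0)`_i = 0 & (p 0 0)`_i =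
  (p 1 1)`_i].
  move=> im; have kn : (i.*2 < n)%N by lia.
  have [] := coef_entry_current_mx two_neq0 p i.*2;
    rewrite !p0 // odd_double doubleK expr0 mul1r.
  by move=> <- <- /esym/half_eq0/eqP; rewrite subr_eq0 => /eqP -> _.
have p00 : p 0 0 = (p 0 0)`_m.-1 *: in_qpoly 'X^m 'X^(m.-1) :> A.
  apply: (qpoly_Xn_ext m_gt0) => i im; rewrite coefZ.
  rewrite coef_in_qpoly_Xn // coefXn; case: eqP => [->|im'];
    first by rewrite mulr1.
  have kn : (i.*2.+1 < n)%N by lia.
  have [_ _ + _] := coef_entry_current_mx two_neq0 p i.*2.+1.
  rewrite !p0 //= odd_double /= uphalf_double expr1 mulN1r opprK.
  have [_ _ <-] := even_k i im => /esym/half_eq0/eqP.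
  by rewrite mulr0 -mulr2n -mulr_natl mulf_eq0 (negPf two_neq0) => /eqP.
have p01 : p 0 1 =
  0 by apply: (qpoly_Xn_ext m_gt0) => i /even_k[-> _ _]; rewrite coef0.
have p10 : p 1 0 =
  0 by apply: (qpoly_Xn_ext m_gt0) => i /even_k[_ -> _]; rewrite coef0.
have p11 : p 1 1 = p 0 0 by apply: (qpoly_Xn_ext m_gt0) => i /even_k[_ _ ->].
apply/vlineP; exists (p 0 0)`_m.-1;
  rewrite -linearZr_LR /= -p00 entry_tens_scalar.
by rewrite /entry_tens !sum_ord2 /= p01 p10 p11.
Qed.

Lemma current_to_form_limg : limg (linfun current_to_form) = fullv.
Proof.
apply/eqP; rewrite eqEsubv subvf /=; apply/subvP => z _.
by have [y <-] := current_to_form_surj z;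
  rewrite -(lfunE current_to_form) memv_img ?memvf.
Qed.

(** Rank-nullity: [4 (n+1)/2 - 1 = 2n + 1]. *)
Lemma dim_form_lie : \dim {: form_lie f} = (2 * n + 1)%N.
Proof.
have := limg_ker_dim (linfun current_to_form) fullv.
rewrite capfv current_to_form_limg current_to_form_ker (dim_top_tensor F m_gt0)
  (dim_current_gl2 F m_gt0) => dimE.
by apply: (@addnI 1); rewrite dimE; lia.
Qed.

Lemma opmx_scaleXn k M v : op ('X^k *: M) v = iter k T (op M v).
Proof.
rewrite -polyactXn [LHS]lfunE [op M v]lfunE /= /opmx_fun linear_sumr.
apply: eq_bigr => i _ /=; rewrite -polyactM mulr_sumr; congr polyact.
by apply: eq_bigr => j _; rewrite mxE mulrA.
Qed.

Lemma sigma_nil v : iter n T v = 0.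
Proof.
rewrite -polyactXn [v](hcoord_span b_gram n_gt0 dimV) linear_sumr big1 // => i
  _ /=.
by rewrite -polyactM mulrC polyactM polyactXn (polyact_Xn_b b_gram n_gt0 dimV)
  linear0r.
Qed.

(** The image of [E_01 X^(m-1)], that is, [T^(n-1)] composed with the map
    sending [b 1] to [b 0] and [b 0] to zero. *)
Definition top_nilpotent : form_lie f :=
  current_to_form (tens_pure (delta_mx 0 1) (in_qpoly 'X^m 'X^(m.-1) : A)).

Lemma top_nilpotentE v :
  vsval top_nilpotent v = iter n.-1 T (op (current_mx (delta_mx 0 1) 1) v).
Proof.
rewrite /top_nilpotent current_to_formE current_to_form_pureE
  opmx_current_mx_mod -opmx_scaleXn.
have tr0 : half_trace (delta_mx 0 1 : 'M[F]_2) = 0.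
  by rewrite /half_trace /mxtrace sum_ord2 !mxE /= addr0 mulr0.
congr (op _ v); rewrite /current_mx tr0 !mul0r !raddf0 !addr0 comp_polyC
  scale1r.
by rewrite comp_Xn_poly -exprM; congr ('X^_ *: _); lia.
Qed.

(** [T^(n-1)] maps [V] into [ker T], and kills [ker T] when [n - 1 > 0]. *)
Lemma top_nilpotent_annihil : (1 < n)%N ->
  top_nilpotent \in form_lie_annihil f (lker T).
Proof.
move=> n_gt1; apply/form_lie_annihilP; split=> [v|w].
  by rewrite memv_ker top_nilpotentE -iterS prednK // sigma_nil.
rewrite memv_ker top_nilpotentE => /eqP Tw.
have opT k v : op (current_mx (delta_mx 0 1) 1) (iter k T v) =
  iter k T (op (current_mx (delta_mx 0 1) 1) v).
  by elim: k => //= k IH; rewrite (opmx_comm b_gram n_gt0 dimV) IH.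
rewrite -opT -(prednK (_ : 0 < n.-1)%N); last by lia.
by rewrite iterSr Tw -polyactXn linear0r linear0.
Qed.

(** Its bracket with the image of [E_10] is [T^(n-1)] composed with
    [E_00 - E_11]. *)
Lemma top_nilpotent_noncentral : top_nilpotent \notin lie_center (form_lie f).
Proof.
apply/lie_centerP => /(_ (current_to_form (tens_pure (delta_mx 1 0) (1 : A)))).
rewrite -current_to_form_morph lie_current mulr1 current_to_formE => /(congr1
  vsval).
rewrite current_to_form_pureE linear0 -opmx0 opmx_current_mx_mod => /eqP.
move=> /opmx_eq-/(_ b_gram n_gt0 dimV 0 0)/polyP/(_ n.-1).
have -> : (0 : 'M[{poly F}]_2) 0 0 = 0 by rewrite mxE.
rewrite !coef_take_poly prednK // leqnn coef0.
have n_even : odd n.-1 = false by lia.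
have n_half : n.-1./2 = m.-1 by lia.
have lie01 : lie (delta_mx 0 1) (delta_mx 1 0) =
  delta_mx 0 0 - delta_mx 1 1 :> 'M[F]_2.
  by rewrite /lie /= /gl_mx_bracket !mul_delta_mx.
have [_ _ + _] :=
  coef_current_mx two_neq0 (lie (delta_mx 0 1) (delta_mx 1 0)) 'X^(m.-1) n.-1.
rewrite n_even n_half coefXn eqxx lie01 => ->.
rewrite !mxE /= => /eqP.
rewrite expr0 mul1r mulr1 subr0 sub0r opprK mulf_eq0 invr_eq0 (negPf two_neq0)
  /=.
by [].
Qed.

(** For [n = 1] the current algebra is [gl_2] itself, and its identity matrix
    goes to zero, so the images of the standard basis of [sl_2] span. *)
Lemma one_block_reductive : n = 1%N -> lie_reductive (form_lie f).
Proof.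
move=> n1; pose t (a : 'M[F]_2) : cur := tens_pure a (1 : A).
pose x := current_to_form (t (delta_mx 0 1));
  pose y := current_to_form (t (delta_mx 1 0)).
pose H := current_to_form (t (delta_mx 0 0 - delta_mx 1 1)).
have tlie a a' : lie (current_to_form (t a)) (current_to_form (t a')) =
  current_to_form (t (lie a a')).
  by rewrite -current_to_form_morph lie_current mulr1.
have tZ c a : c *: current_to_form (t a) = current_to_form (t (c *: a)).
  by rewrite /t linearZl_LR linearZ.
have dd (i j k l : 'I_2) : (delta_mx i j : 'M[F]_2) *m delta_mx k l =
  (delta_mx i l) *+ (j == k).
  by have [->|jk] := eqVneq j k; rewrite ?mul_delta_mx ?mul_delta_mx_0.
apply: (@sl2_reductive F _ x y H two_neq0).
- rewrite tlie tZ; congr (current_to_form (t _)).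
  rewrite /lie /= /gl_mx_bracket mulmxBl mulmxBr !dd /= !mulr0n !mulr1n.
  by rewrite subr0 sub0r opprK scaler_nat mulr2n.
- rewrite tlie tZ; congr (current_to_form (t _)).
  rewrite /lie /= /gl_mx_bracket mulmxBl mulmxBr !dd /= !mulr0n !mulr1n.
  by rewrite subr0 sub0r scaleNr scaler_nat mulr2n opprD.
- rewrite tlie; congr (current_to_form (t _)).
  by rewrite /lie /= /gl_mx_bracket !dd.
move=> z; have [v <-] := current_to_form_surj z;
  have [p ->] := entry_tens_surj v.
have pE i j : p i j = (p i j)`_0 *: (1 : A).
  apply: (qpoly_Xn_ext m_gt0) => k km; have -> : k = 0%N by lia.
  by rewrite coefZ coefC mulr1.
have top0 : current_to_form (t 1%:M) = 0.
  have : top_tensor F m \in lker (linfun current_to_form) by rewrite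
    current_to_form_ker memv_line.
  rewrite memv_ker lfunE /= /top_tensor (_ : in_qpoly _ _ = 1 :> A) => [/eqP
    //|].
  by rewrite [in X in in_qpoly _ X]n1 expr0 rmorph1.
pose c i j := (p i j)`_0; pose half := 2%:R^-1 : F.
have tD a a' : current_to_form (t a) + current_to_form (t a') =
  current_to_form (t (a + a')).
  by rewrite /t linearDl linearD.
have -> : entry_tens p = t (\matrix_(i, j) c i j).
  rewrite /t [\matrix_(i, j) _]matrix_sum_delta /entry_tens linear_sumlz.
  apply: eq_bigr => i _; rewrite /= linear_sumlz; apply: eq_bigr => j _ /=.
  by rewrite mxE linearZl_LR /= -linearZr_LR /= -pE.
exists (c 0 1), (c 1 0), (half * (c 0 0 - c 1 1)).
(* The scalar component may be added freely, as its image is zero. *)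
rewrite -[RHS]addr0 -(scaler0 _ (half * (c 0 0 + c 1 1))) -top0 !tZ !tD.
congr (current_to_form (t _)); apply/matrixP; apply: ord2_ind; apply: ord2_ind;
  rewrite !mxE /= /half; first [by ring | by field; rewrite two_neq0].
Qed.

End CurrentHom.

Theorem proposition9p1 (F : fieldType) (charF : 2%N \notin [pchar F])
    (n : nat) (n_gt0 : (1 <= n)%N) (n_odd : odd n)
    (V : vectType F) (f : {biscalar V})
    (e : (n + n).-tuple V) (e_basis : basis_of {:V} e)
    (f_gram : forall i j : 'I_(n + n), f e`_i e`_j = gram_A n (-1) i j) :
  [/\ \dim {: form_lie f} = (2 * n + 1)%N,
      exists Z : lieIdeal (current 'M[F]_2 (n + 1)./2),
        [/\ \dim Z = 1%N,
            (Z <= lie_center (current 'M[F]_2 (n + 1)./2))%VS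
          & lie_isomorphic (form_lie f) (quot_lie Z)],
      lie_reductive (form_lie f) <-> n = 1%N
    & let W := lker (sigma_mp f) in
      let K := form_lie_annihil f W in
      [/\ lie_ideal K,
          lie_abelian K
        & (1 < n)%N -> ~~ (K <= lie_center (form_lie f))%VS]].
Proof.
have two_neq0 : 2%:R != 0 :> F by move: charF; rewrite inE.
have ndeg := form_minus_ndeg two_neq0 n_gt0 e_basis f_gram.
have [b b_gram] := hyperbolic_pair two_neq0 n_gt0 e_basis f_gram n_odd.
have dimV : \dim {:V} = (2 * n)%N.
  by rewrite (size_basis e_basis) mul2n addnn.
have K_ideal : lie_ideal (form_lie_annihil f (lker (sigma_mp f))).
  apply: annihil_ideal => x w; rewrite !memv_ker => /eqP Tw.
  have /form_lie_sigmaP[//|//|xT _] := subvsP x.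
  by rewrite -xT Tw linear0.
have K_noncentral : (1 < n)%N ->
    ~~ (form_lie_annihil f (lker (sigma_mp f)) <= lie_center (form_lie f))%VS.
  move=> n_gt1; apply/subvPn; exists (top_nilpotent f n b).
    exact: top_nilpotent_annihil.
  exact: top_nilpotent_noncentral.
split.
- exact: dim_form_lie dimV.
- have topI : lie_ideal <[top_tensor F (n + 1)./2]>%VS.
    move=> x y /(subvP (top_tensor_central F (n + 1)./2))/lie_centerP y0.
    by rewrite lie_skew y0 oppr0 mem0v.
  exists (LieIdeal topI); split; first by apply: dim_top_tensor; lia.
    exact: top_tensor_central.
  have := @surj_lie_isomorphic F (current 'M[F]_2 (n + 1)./2) (form_lie f)
    (current_to_form f b) (LieIdeal topI).
  apply; [exact: current_to_form_morph | exact: current_to_form_surj |].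
  exact: current_to_form_ker.
- split=> [redL|n1]; last exact: one_block_reductive n1.
  case: (ltnP 1 n) => [n_gt1|]; last by lia.
  have /negP[] := K_noncentral n_gt1; apply: redL => //.
  exact/abelian_solvable/annihil_abelian.
- by split; [| exact: annihil_abelian |].
Qed.
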